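(* Let $G_V$ be a graph product group over a finite simple graph with vertex set $V$, and assume that for each vertex $v\in V$ the spherical growth rate and the spherical conjugacy growth rate of $G_v$ over a generating set $X_v$ are equal. Let $X_V=\bigcup_{v\in V}X_v$. Then the spherical growth rate and the spherical conjugacy growth rate of $G_V$ with respect to $X_V$ are equal. Hence also the radii of convergence of the spherical growth series and of the spherical conjugacy growth series of $G_V$ over $X_V$ are equal.
   Context: All groups are finitely generated and all generating sets are finite and inverse-closed. Let $\Gamma=(V,E)$ be a finite simple graph and for each $v\in V$ let $G_v$ be a nontrivial group. The graph product $G_V$ is the quotient of the free product of the $G_v$ by the normal closure of all commutators $[g_v,g_w]$ with $g_v\in G_v$, $g_w\in G_w$, $\{v,w\}\in E$. For a group $G$ with finite inverse-closed generating set $X$, the length $\|g\|$ of $g\in G$ is the length of a shortest word over $X$ representing $g$. Let $a_n$ be the number of elements of $G$ of length $n$, and let $\tilde a_n$ be the number of conjugacy classes of $G$ whose minimal-length elements have length $n$. The spherical growth series is $\sigma(z)=\sum_{n\ge0}a_nz^n$ and the spherical conjugacy growth series is $\tilde\sigma(z)=\sum_{n\ge0}\tilde a_nz^n$. The spherical growth rate is $\lim_{n\to\infty}a_n^{1/n}$ and the spherical conjugacy growth rate is $\limsup_{n\to\infty}\tilde a_n^{1/n}$. *)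

(* Defs.v *)
From HB Require Import structures.
From mathcomp Require Import all_boot all_order all_algebra.
From mathcomp Require Import finmap all_classical all_reals all_analysis.

Set Implicit Arguments.
Unset Strict Implicit.
Unset Printing Implicit Defensive.

Import Order.TTheory GRing.Theory Num.Theory.
Import numFieldNormedType.Exports.

Local Open Scope classical_set_scope.
Local Open Scope quotient_scope.
Local Open Scope group_scope.

Section FreeProduct.
Variables (V : finType) (G : V -> groupType).

Definition fp_letter : Type := {v : V & G v}.
HB.instance Definition _ := Choice.on fp_letter.

Definition fp_word := seq fp_letter.
HB.instance Definition _ := Choice.on fp_word.

Definition letter v (g : G v) : fp_letter := Tagged G g.

(* The congruence on words in the disjoint union of the G v generated by (v, 1) ~ empty word and
   (v, g)(v, h) ~ (v, g * h). *)
Inductive fp_eqv : fp_word -> fp_word -> Prop :=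
| fp_refl s : fp_eqv s s
| fp_sym s t : fp_eqv s t -> fp_eqv t s
| fp_trans s t u : fp_eqv s t -> fp_eqv t u -> fp_eqv s u
| fp_one s t v : fp_eqv (s ++ letter (1 : G v) :: t) (s ++ t)
| fp_mul s t v (g h : G v) :
    fp_eqv (s ++ letter g :: letter h :: t) (s ++ letter (g * h) :: t).

Definition fp_rel : rel fp_word := fun s t => `[< fp_eqv s t >].

Fact fp_rel_refl : reflexive fp_rel.
Proof. by move=> s; apply/asboolP; exact: fp_refl. Qed.

Fact fp_rel_sym : symmetric fp_rel.
Proof. by move=> s t; apply/asboolP/asboolP; exact: fp_sym. Qed.

Fact fp_rel_trans : transitive fp_rel.
Proof.
by move=> t s u /asboolP st /asboolP tu; apply/asboolP; exact: fp_trans tu.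
Qed.

Canonical fp_equiv := EquivRel fp_rel fp_rel_refl fp_rel_sym fp_rel_trans.

Definition free_product := {eq_quot fp_equiv}.
HB.instance Definition _ := Choice.on free_product.
HB.instance Definition _ := EqQuotient.on free_product.

Definition fp_class (s : fp_word) : free_product := \pi s.

Lemma fp_classP s t : fp_class s = fp_class t <-> fp_eqv s t.
Proof. by split=> [/eqmodP/asboolP //|st]; apply/eqmodP/asboolP. Qed.

Lemma fp_class_repr (x : free_product) : fp_class (repr x) = x.
Proof. exact: reprK. Qed.

Lemma fp_repr_class s : fp_eqv (repr (fp_class s)) s.
Proof. by apply/fp_classP; rewrite fp_class_repr. Qed.

Lemma fp_eqv_catl u s t : fp_eqv s t -> fp_eqv (u ++ s) (u ++ t).
Proof.
elim=> {s t} [s|s t _|s t r _ st _|s t v|s t v g h]; rewrite ?catA.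
- exact: fp_refl.
- exact: fp_sym.
- exact: fp_trans.
- exact: fp_one.
- exact: fp_mul.
Qed.

Lemma fp_eqv_catr u s t : fp_eqv s t -> fp_eqv (s ++ u) (t ++ u).
Proof.
elim=> {s t} [s|s t _|s t r _ st _|s t v|s t v g h]; rewrite -?catA /=.
- exact: fp_refl.
- exact: fp_sym.
- exact: fp_trans.
- exact: fp_one.
- exact: fp_mul.
Qed.

Lemma fp_eqv_cat s s' t t' :
  fp_eqv s s' -> fp_eqv t t' -> fp_eqv (s ++ t) (s' ++ t').
Proof.
by move=> ss tt; exact: fp_trans (fp_eqv_catr _ ss) (fp_eqv_catl _ tt).
Qed.

Definition letter_inv (l : fp_letter) : fp_letter :=
  letter (tagged l : G (tag l))^-1.

Definition fp_inv_word (s : fp_word) : fp_word := rev (map letter_inv s).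

Lemma fp_inv_word_cat s t :
  fp_inv_word (s ++ t) = fp_inv_word t ++ fp_inv_word s.
Proof. by rewrite /fp_inv_word map_cat rev_cat. Qed.

Lemma fp_inv_word_cons l s :
  fp_inv_word (l :: s) = rcons (fp_inv_word s) (letter_inv l).
Proof. by rewrite /fp_inv_word /= rev_cons. Qed.

Lemma fp_inv_wordP s t : fp_eqv s t -> fp_eqv (fp_inv_word s) (fp_inv_word t).
Proof.
elim=> {s t} [s|s t _|s t r _ st _|s t v|s t v g h].
- exact: fp_refl.
- exact: fp_sym.
- exact: fp_trans.
- rewrite !fp_inv_word_cat fp_inv_word_cons cat_rcons /letter_inv /= invg1; exact: fp_one.
- rewrite !fp_inv_word_cat !fp_inv_word_cons !cat_rcons /letter_inv /= invgM; exact: fp_mul.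
Qed.

Lemma fp_inv_wordK : involutive fp_inv_word.
Proof.
move=> s; rewrite /fp_inv_word map_rev revK -map_comp map_id_in // => -[v g] _.
by rewrite /= /letter_inv /letter /= invgK.
Qed.

Lemma fp_inv_wordV s : fp_eqv (fp_inv_word s ++ s) [::].
Proof.
elim: s => [|[v g] s IHs]; first exact: fp_refl.
rewrite fp_inv_word_cons cat_rcons /letter_inv /=.
apply: fp_trans (fp_mul _ _ _ _) _; rewrite mulVg.
exact: fp_trans (fp_one _ _ _) IHs.
Qed.

Definition fp_unit : free_product := fp_class [::].
Definition fp_op (x y : free_product) : free_product :=
  fp_class (repr x ++ repr y).
Definition fp_inv (x : free_product) : free_product :=
  fp_class (fp_inv_word (repr x)).

Lemma fp_opE s t : fp_op (fp_class s) (fp_class t) = fp_class (s ++ t).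
Proof. by apply/fp_classP/fp_eqv_cat; exact: fp_repr_class. Qed.

Lemma fp_invE s : fp_inv (fp_class s) = fp_class (fp_inv_word s).
Proof. exact/fp_classP/fp_inv_wordP/fp_repr_class. Qed.

Fact fp_opA : associative fp_op.
Proof.
move=> x y z; rewrite -(fp_class_repr x) -(fp_class_repr y) -(fp_class_repr z).
by rewrite !fp_opE catA.
Qed.

Fact fp_op1x : left_id fp_unit fp_op.
Proof. by move=> x; rewrite -(fp_class_repr x) fp_opE. Qed.

Fact fp_opx1 : right_id fp_unit fp_op.
Proof. by move=> x; rewrite -(fp_class_repr x) fp_opE cats0. Qed.

Fact fp_opVx : left_inverse fp_unit fp_inv fp_op.
Proof.
move=> x; rewrite -(fp_class_repr x) fp_invE fp_opE.
exact/fp_classP/fp_inv_wordV.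
Qed.

Fact fp_opxV : right_inverse fp_unit fp_inv fp_op.
Proof.
move=> x; rewrite -(fp_class_repr x) fp_invE fp_opE; apply/fp_classP.
by rewrite -[X in X ++ _]fp_inv_wordK; exact: fp_inv_wordV.
Qed.

HB.instance Definition _ :=
  isGroup.Build free_product fp_opA fp_op1x fp_opx1 fp_opVx fp_opxV.

Definition fp_in v (g : G v) : free_product := fp_class [:: letter g].

Lemma fp_class_prod s : fp_class s = \prod_(l <- s) fp_in (tagged l : G (tag l)).
Proof.
elim: s => [|[v g] s IHs]; first by rewrite big_nil.
by rewrite big_cons -IHs /fp_in; exact/esym/fp_opE.
Qed.

Lemma fp_inV v (g : G v) : (fp_in g)^-1 = fp_in g^-1.
Proof. exact: fp_invE. Qed.

Lemma fp_in1 v : fp_in (1 : G v) = 1.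
Proof. exact/fp_classP/(fp_one [::] [::]). Qed.

Lemma fp_inM v (g h : G v) : fp_in (g * h) = fp_in g * fp_in h.
Proof.
rewrite /fp_in; symmetry; transitivity (fp_class ([:: letter g] ++ [:: letter h])).
  exact: fp_opE.
exact/fp_classP/(fp_mul [::] [::]).
Qed.

End FreeProduct.

Section NormalQuotient.
Variables (H : groupType) (S : set H).

Definition normal_subgroup (N : set H) : Prop :=
  [/\ N 1, forall x y, N x -> N y -> N (x * y),
      forall x, N x -> N x^-1 & forall x y, N x -> N (x ^ y)].

Definition normal_closure : set H :=
  \bigcap_(N in [set N | normal_subgroup N /\ S `<=` N]) N.

Lemma normal_closureP : normal_subgroup normal_closure.
Proof.
split=> [N [[]]//|x y xS yS N NS|x xS N NS|x y xS N NS].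
- by case: (NS) => -[_ NM _ _] _; apply: NM; [exact: xS|exact: yS].
- by case: (NS) => -[_ _ NV _] _; apply: NV; exact: xS.
- by case: (NS) => -[_ _ _ NJ] _; apply: NJ; exact: xS.
Qed.

Lemma sub_normal_closure : S `<=` normal_closure.
Proof. by move=> x Sx N [_]; exact. Qed.

Definition nq_rel : rel H := fun x y => `[< normal_closure (x^-1 * y) >].

Fact nq_rel_refl : reflexive nq_rel.
Proof. by move=> x; apply/asboolP; rewrite mulVg; case: normal_closureP. Qed.

Fact nq_rel_sym : symmetric nq_rel.
Proof.
have [_ _ NV _] := normal_closureP.
by move=> x y; apply/asboolP/asboolP => /NV; rewrite invgM invgK.
Qed.

Fact nq_rel_trans : transitive nq_rel.
Proof.
have [_ NM _ _] := normal_closureP.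
move=> y x z /asboolP xy /asboolP yz; apply/asboolP.
by have := NM _ _ xy yz; rewrite mulgA mulgK.
Qed.

Canonical nq_equiv := EquivRel nq_rel nq_rel_refl nq_rel_sym nq_rel_trans.

Definition normal_quotient := {eq_quot nq_equiv}.
HB.instance Definition _ := Choice.on normal_quotient.
HB.instance Definition _ := EqQuotient.on normal_quotient.

Definition nq_class (x : H) : normal_quotient := \pi x.

Lemma nq_classP x y : nq_class x = nq_class y <-> normal_closure (x^-1 * y).
Proof. by split=> [/eqmodP/asboolP //|xy]; apply/eqmodP/asboolP. Qed.

Lemma nq_class_repr (a : normal_quotient) : nq_class (repr a) = a.
Proof. exact: reprK. Qed.

Lemma nq_repr_class x : normal_closure ((repr (nq_class x))^-1 * x).
Proof. by apply/nq_classP; rewrite nq_class_repr. Qed.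

Definition nq_unit : normal_quotient := nq_class 1.
Definition nq_op (a b : normal_quotient) : normal_quotient :=
  nq_class (repr a * repr b).
Definition nq_inv (a : normal_quotient) : normal_quotient :=
  nq_class (repr a)^-1.

Lemma nq_opE x y : nq_op (nq_class x) (nq_class y) = nq_class (x * y).
Proof.
have [_ NM _ NJ] := normal_closureP.
apply/nq_classP; rewrite invgM.
set x' := repr (nq_class x); set y' := repr (nq_class y).
have -> : y'^-1 * x'^-1 * (x * y) = y'^-1 * y * (x'^-1 * x) ^ y.
  by rewrite conjgE !mulgA mulgK.
by apply: NM; [|apply: NJ]; exact: nq_repr_class.
Qed.

Lemma nq_invE x : nq_inv (nq_class x) = nq_class x^-1.
Proof.
have [_ _ NV NJ] := normal_closureP.
apply/nq_classP; rewrite invgK; set x' := repr _.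
have -> : x' * x^-1 = (x'^-1 * x)^-1 ^ x^-1.
  by rewrite conjgE invgM !invgK !mulgA mulgV mul1g.
by apply: NJ; apply: NV; exact: nq_repr_class.
Qed.

Fact nq_opA : associative nq_op.
Proof.
move=> a b c; rewrite -(nq_class_repr a) -(nq_class_repr b) -(nq_class_repr c).
by rewrite !nq_opE mulgA.
Qed.

Fact nq_op1x : left_id nq_unit nq_op.
Proof. by move=> a; rewrite -(nq_class_repr a) nq_opE mul1g. Qed.

Fact nq_opx1 : right_id nq_unit nq_op.
Proof. by move=> a; rewrite -(nq_class_repr a) nq_opE mulg1. Qed.

Fact nq_opVx : left_inverse nq_unit nq_inv nq_op.
Proof. by move=> a; rewrite -(nq_class_repr a) nq_invE nq_opE mulVg. Qed.

Fact nq_opxV : right_inverse nq_unit nq_inv nq_op.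
Proof. by move=> a; rewrite -(nq_class_repr a) nq_invE nq_opE mulgV. Qed.

HB.instance Definition _ :=
  isGroup.Build normal_quotient nq_opA nq_op1x nq_opx1 nq_opVx nq_opxV.

Lemma nq_class1 : nq_class 1 = 1. Proof. by []. Qed.

Lemma nq_classM x y : nq_class (x * y) = nq_class x * nq_class y.
Proof. exact/esym/nq_opE. Qed.

Lemma nq_classV x : nq_class x^-1 = (nq_class x)^-1.
Proof. exact/esym/nq_invE. Qed.

End NormalQuotient.

Record genset (G : groupType) := GenSet {
  gens :> set G;
  gens_finite : finite_set gens;
  gensV : forall x, gens x -> gens x^-1;
  gens_gen : forall g, exists2 w : seq G,
    [set` w] `<=` gens & \prod_(x <- w) x = g }.

Section Growth.
Variables (G : groupType) (X : genset G).

Definition has_word (g : G) : pred nat := fun n =>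
  `[< exists w : seq G, [/\ [set` w] `<=` X, size w = n & \prod_(x <- w) x = g] >].

Lemma ex_word g : exists n, has_word g n.
Proof.
by have [w wX wg] := gens_gen X g; exists (size w); apply/asboolP; exists w.
Qed.

Definition word_length (g : G) : nat := ex_minn (ex_word g).

Definition conj_class (g : G) : set G := [set g ^ h | h in [set: G]].

Definition sphere (n : nat) : set G := [set g | word_length g = n].

Definition conj_sphere (n : nat) : set (set G) :=
  [set C | exists2 g, C = conj_class g & word_length g = n /\
           forall h, C h -> (n <= word_length h)%N].

(* The spheres and conjugacy spheres are finite since X is, so that fset_set
   does not take its default value. *)
Definition sphere_size (n : nat) : nat := #|` fset_set (sphere n)|%fset.

Definition conj_sphere_size (n : nat) : nat :=
  #|` fset_set (conj_sphere n)|%fset.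

Variable R : realType.
Local Open Scope ring_scope.

(* The nth-root sequences are bounded (for n > 0, by the number of generators); the first
   one converges because sphere_size is submultiplicative. *)
Definition spherical_growth_rate : R :=
  limn (fun n => (sphere_size n)%:R `^ (n%:R^-1) : R).

Definition conj_growth_rate : R :=
  limn_sup (fun n => (conj_sphere_size n)%:R `^ (n%:R^-1) : R).

Definition spherical_growth_coef : R^nat := fun n => (sphere_size n)%:R.

Definition conj_growth_coef : R^nat := fun n => (conj_sphere_size n)%:R.

End Growth.

Arguments spherical_growth_rate {G} X R.
Arguments conj_growth_rate {G} X R.
Arguments spherical_growth_coef {G} X R.
Arguments conj_growth_coef {G} X R.

Definition convergence_radius (R : realType) (a : R^nat) : \bar R :=
  ereal_sup [set (`|x|%R)%:E | x in [set x : R | cvgn (pseries a x)]].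

Section GraphProduct.
Variables (V : finType) (e : rel V) (G : V -> groupType).

Definition graph_commutators : set (free_product G) :=
  [set x | exists (v w : V) (g : G v) (h : G w),
           e v w /\ x = [~ fp_in g, fp_in h]].

Definition graph_product := normal_quotient graph_commutators.
HB.instance Definition _ := Choice.on graph_product.
HB.instance Definition _ := Group.on graph_product.

Definition gp_in v (g : G v) : graph_product :=
  nq_class graph_commutators (fp_in g).

Lemma gp_in1 v : gp_in (1 : G v) = 1.
Proof. by rewrite /gp_in fp_in1; exact: nq_class1. Qed.

Lemma gp_inM v (g h : G v) : gp_in (g * h) = gp_in g * gp_in h.
Proof. by rewrite /gp_in fp_inM; exact: nq_classM. Qed.

Lemma gp_inV v (g : G v) : gp_in g^-1 = (gp_in g)^-1.
Proof. by rewrite /gp_in -fp_inV; exact: nq_classV. Qed.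

Variable X : forall v, genset (G v).

Definition gp_gens : set graph_product :=
  \bigcup_(v in [set: V]) (@gp_in v @` X v).

Fact gp_gens_finite : finite_set gp_gens.
Proof.
apply: bigcup_finite => [|v _]; first exact: finite_finset.
exact/finite_image/gens_finite.
Qed.

Fact gp_gensV x : gp_gens x -> gp_gens x^-1.
Proof.
case=> v _ [g Xg <-]; exists v => //.
by exists g^-1; [exact: gensV|exact: gp_inV].
Qed.

Fact gp_gens_gen g : exists2 w : seq graph_product,
  [set` w] `<=` gp_gens & \prod_(x <- w) x = g.
Proof.
rewrite -(nq_class_repr g) -(fp_class_repr (repr g)) fp_class_prod.
elim: (repr (repr g)) => [|[v h] s [w wX wE]]; first by exists [::]; rewrite ?big_nil.
have [u uX uE] := gens_gen (X v) h.
exists (map (@gp_in v) u ++ w).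
  move=> x /=; rewrite mem_cat => /orP[/mapP[y yu ->]|]; last exact: wX.
  by exists v => //; exists y => //; exact: uX.
rewrite big_cat big_cons /= wE nq_classM; congr (_ * _).
rewrite -uE big_map; elim: u {uX uE} => [|y u IHu].
  by rewrite !big_nil -[RHS]/(gp_in (1 : G v)) gp_in1.
by rewrite !big_cons IHu -[RHS]/(gp_in (y * _)) gp_inM.
Qed.

Definition gp_genset : genset graph_product :=
  GenSet gp_gens_finite gp_gensV gp_gens_gen.

End GraphProduct.

(* Main.v *)
(* Fix a vertex v and a set U of vertices without v, and let T be the set of shortest
   representatives of the left cosets in G_U of the subgroup generated by the neighbours of v in
   U.  Every element of G_(U + v) is, with additive length, a product s (t_1 s_1) ... (t_k s_k) y
   with 1 <> t_i in T, 1 <> s_i in G_v, s in G_v and y in G_U.  Let 0 < r <= 1 be such that the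
   conjugacy growth series converges at r, and let q be the product of the sum of r^|t| over
   T \ 1 and of the sum of r^|s| over G_v \ 1.  If q < 1, convergence at r of the spherical
   growth series passes from G_U to G_(U + v), by summing a geometric series.  If q >= 1, the
   block words (t_1 s_1) ... (t_k s_k) of length k have total weight q^k >= 1.  Two conjugate
   block words have the same k, and their normal forms (sequences of cosets and elements of G_v,
   on which the graph product acts) are rotations of each other up to translation.  Prefixing a
   fixed block word that rigidifies the translation, only O(k) block words share a conjugacy
   class, so the conjugacy growth series at r dominates a tail of the harmonic series, which is
   absurd.  Adding the vertices one by one, the spherical growth series converges at every
   r <= 1 below the inverse of the conjugacy growth rate. *)

Require Import Defs.
From mathcomp Require Import all_boot all_order all_algebra.
From mathcomp Require Import finmap all_classical all_reals all_analysis.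
From mathcomp Require Import zify ring lra.

Set Implicit Arguments.
Unset Strict Implicit.
Unset Printing Implicit Defensive.

Local Open Scope classical_set_scope.
Local Open Scope quotient_scope.
Local Open Scope group_scope.

(** * Words and retractions *)

(** No normal form theorem for graph products is presupposed. The letters operate on reduced
    sequences of cosets and syllables; compatibility with the defining relations turns this into an
    action of the graph product, so that numbers and lengths of syllables become invariants of
    elements. Reduced words, additivity of length and shortest coset representatives are all derived
    from these invariants. Conjugacy is always that of the full graph product, so a single bound on
    sums over pairwise non-conjugate elements serves for every U in the induction. The condition r
    <= 1 lets inequalities between lengths replace exact formulas, since a shorter element has a
    larger weight. *)

Section Words.
Variables (V : finType) (e : rel V) (G : V -> groupType).
Local Notation Gam := (graph_product e G).
Implicit Types (l : fp_letter G) (w : fp_word G) (A B : {set V}) (x y : Gam).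

Definition gp_letter l : Gam := gp_in e (tagged l).

Definition gpw w : Gam := \prod_(l <- w) gp_letter l.

Lemma gpw_nil : gpw [::] = 1.
Proof. by rewrite /gpw big_nil. Qed.

Lemma gpw_cons l w : gpw (l :: w) = gp_letter l * gpw w.
Proof. by rewrite /gpw big_cons. Qed.

Lemma gpw_cat w w' : gpw (w ++ w') = gpw w * gpw w'.
Proof. by rewrite /gpw big_cat. Qed.

Lemma gpw_class w : gpw w = nq_class _ (fp_class w).
Proof.
elim: w => [|l w IHw]; first by rewrite gpw_nil.
by rewrite gpw_cons IHw !fp_class_prod big_cons nq_classM.
Qed.

Lemma gpw_surj x : exists w, gpw w = x.
Proof. by exists (repr (repr x)); rewrite gpw_class fp_class_repr nq_class_repr. Qed.

Section Action.
Variables (T : Type) (D : T -> Prop) (a : fp_letter G -> T -> T).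
Hypothesis aD : forall l t, D t -> D (a l t).
Hypothesis a1 : forall v t, D t -> a (letter (1 : G v)) t = t.
Hypothesis aM : forall v (g h : G v) t, D t ->
  a (letter g) (a (letter h) t) = a (letter (g * h)) t.
Hypothesis aC : forall v u (g : G v) (h : G u) t, e v u -> D t ->
  a (letter g) (a (letter h) t) = a (letter h) (a (letter g) t).

Lemma foldr_actD w t : D t -> D (foldr a t w).
Proof. by move=> Dt; elim: w => //= l w; exact: aD. Qed.

Lemma fp_eqv_act w w' : fp_eqv w w' -> forall t, D t -> foldr a t w = foldr a t w'.
Proof.
elim=> {w w'} // [w w' _ IH t Dt|w w' w2 _ IH1 _ IH2 t Dt|w w' v t Dt|w w' v g h t Dt].
- by rewrite IH.
- by rewrite IH1 // IH2.
- by rewrite !foldr_cat /= a1 //; exact: foldr_actD.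
- by rewrite !foldr_cat /= aM //; exact: foldr_actD.
Qed.

Let acts_trivially : set (free_product G) :=
  [set x | forall t, D t -> foldr a t (repr x) = t].

Let act_class w t : D t -> foldr a t (repr (fp_class w)) = foldr a t w.
Proof. by move=> Dt; apply: fp_eqv_act => //; exact: fp_repr_class. Qed.

Let act_mul (x y : free_product G) t : D t ->
  foldr a t (repr (x * y)) = foldr a (foldr a t (repr y)) (repr x).
Proof.
move=> Dt; rewrite -(fp_class_repr x) -(fp_class_repr y).
rewrite -[fp_class _ * _]/(fp_op _ _) fp_opE act_class // foldr_cat.
by rewrite !act_class //; apply: foldr_actD.
Qed.

Let act_one t : D t -> foldr a t (repr (1 : free_product G)) = t.
Proof. by move=> Dt; rewrite -[1]/(fp_class [::]) act_class. Qed.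

Let acts_trivially_normal : normal_subgroup acts_trivially.
Proof.
split=> [t Dt|x y xT yT t Dt|x xT t Dt|x y xT t Dt].
- exact: act_one.
- by rewrite act_mul // yT ?xT.
- by rewrite -[in LHS](xT t Dt) -act_mul // mulVg act_one.
- have Dy : D (foldr a t (repr y)) by exact: foldr_actD.
  rewrite conjgE act_mul // act_mul; last exact: Dt.
  by rewrite xT // -act_mul // mulVg act_one.
Qed.

Let act_in v (g : G v) t : D t -> foldr a t (repr (fp_in g)) = a (letter g) t.
Proof. exact: act_class. Qed.

Let acts_trivially_comm : graph_commutators e (G := G) `<=` acts_trivially.
Proof.
move=> x [v [u [g [h [evu ->]]]]] t Dt.
rewrite commgEl conjgE mulgA -invgM.
have Da l : D (a l t) by exact: aD.
have Dr s (x' : free_product G) : D s -> D (foldr a s (repr x')) by move=> *; exact: foldr_actD.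
rewrite act_mul // [X in foldr a X _](_ : _ = foldr a t (repr (fp_in h * fp_in g))).
  by rewrite -act_mul // mulVg act_one.
by rewrite !act_mul // !act_in //; exact: aC.
Qed.

(** The elements acting trivially form a normal subgroup containing the graph commutators, hence
    their normal closure, so the operation of the letters descends to the graph product. [D] singles
    out the states on which the relations hold. *)
Lemma gpw_act w w' : gpw w = gpw w' -> forall t, D t -> foldr a t w = foldr a t w'.
Proof.
rewrite !gpw_class => /nq_classP Nww' t Dt.
have /(_ t Dt) xt := Nww' _ (conj acts_trivially_normal acts_trivially_comm).
by rewrite -(act_class w') // -[fp_class w'](mulVKg (fp_class w)) act_mul // xt act_class.
Qed.

End Action.

Definition gp_word (x : Gam) : fp_word G := projT1 (cid (gpw_surj x)).

Lemma gp_wordK x : gpw (gp_word x) = x.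
Proof. by rewrite /gp_word; case: cid. Qed.

Definition retr A (x : Gam) : Gam := gpw [seq l <- gp_word x | tag l \in A].

Lemma gp_inC v u (g : G v) (h : G u) : e v u ->
  gp_in e g * gp_in e h = gp_in e h * gp_in e g.
Proof.
move=> evu; apply/esym; rewrite /gp_in -!nq_classM; apply/nq_classP => N [_]; apply.
by exists v, u, g, h; split=> //; rewrite commgEl conjgE invgM !mulgA.
Qed.

(** Deletion of letters is the orbit of 1 under left multiplication with the letters outside A
    acting trivially, so [gpw_act] makes it independent of the word. *)
Lemma retr_gpw A w : retr A (gpw w) = gpw [seq l <- w | tag l \in A].
Proof.
pose a l x := (if tag l \in A then gp_letter l else 1) * x.
have aE w' : foldr a 1 w' = gpw [seq l <- w' | tag l \in A].
  elim: w' => [|l w' /= ->]; first by rewrite gpw_nil.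
  by rewrite /a; case: ifP; rewrite ?gpw_cons ?mul1g.
rewrite /retr -!aE; apply: (gpw_act (D := fun=> True)) => //; last exact: gp_wordK.
- by move=> v t _; rewrite /a /gp_letter /= gp_in1 if_same mul1g.
- by move=> v g h t _; rewrite /a /gp_letter /= gp_inM; case: ifP; rewrite ?mul1g ?mulgA.
- move=> v u g h t evu _; rewrite /a /gp_letter /=.
  by do 2 case: ifP => _; rewrite ?mul1g // !mulgA (gp_inC _ _ evu).
Qed.

Lemma retrM A x y : retr A (x * y) = retr A x * retr A y.
Proof.
by rewrite -(gp_wordK x) -(gp_wordK y) -gpw_cat !retr_gpw filter_cat gpw_cat.
Qed.

Lemma retr1 A : retr A 1 = 1.
Proof. by rewrite -gpw_nil retr_gpw. Qed.

Lemma retrV A x : retr A x^-1 = (retr A x)^-1.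
Proof. by apply: (mulIg (retr A x)); rewrite -retrM !mulVg retr1. Qed.

Lemma retr_retr A B x : retr A (retr B x) = retr (A :&: B) x.
Proof.
rewrite -(gp_wordK x) !retr_gpw -filter_predI; congr gpw; apply: eq_filter => l /=.
by rewrite inE.
Qed.

(* The subgroup generated by the vertex groups in A is the set of fixed points of its
   retraction. *)
Definition gpsub A : set Gam := [set x | retr A x = x].

Lemma gpsub_retr A x : gpsub A (retr A x).
Proof. by rewrite /gpsub /= retr_retr finset.setIid. Qed.

Lemma gpsub1 A : gpsub A 1. Proof. exact: retr1. Qed.

Lemma gpsubM A x y : gpsub A x -> gpsub A y -> gpsub A (x * y).
Proof. by rewrite /gpsub /= retrM => -> ->. Qed.

Lemma gpsubV A x : gpsub A x -> gpsub A x^-1.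
Proof. by rewrite /gpsub /= retrV => ->. Qed.

Lemma gpsubS A B x : A \subset B -> gpsub A x -> gpsub B x.
Proof. by rewrite /gpsub /= => AB <-; rewrite retr_retr (finset.setIidPr AB). Qed.

Lemma gpsubI A B x : gpsub A x -> gpsub B x -> gpsub (A :&: B) x.
Proof. by rewrite /gpsub /= -retr_retr => Ax ->. Qed.

Lemma gpsub_retrI A B x : gpsub A x -> gpsub (A :&: B) (retr B x).
Proof.
move=> Ax; apply: gpsubI; last exact: gpsub_retr.
by rewrite /gpsub /= retr_retr finset.setIC -retr_retr Ax.
Qed.

Lemma gpw_sub A w : all [pred l | tag l \in A] w -> gpsub A (gpw w).
Proof. by rewrite /gpsub /= retr_gpw => /all_filterP ->. Qed.

Lemma gpsubP A x : gpsub A x -> exists2 w, all [pred l | tag l \in A] w & gpw w = x.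
Proof.
by move=> Ax; exists [seq l <- gp_word x | tag l \in A] => //; exact: filter_all.
Qed.

End Words.

(** * Normal form relative to a vertex *)

Section VertexAction.
Variables (V : finType) (e : rel V) (G : V -> groupType).
Hypotheses (e_sym : symmetric e) (e_irr : irreflexive e).
Local Notation Gam := (graph_product e G).
Variable v : V.
Implicit Types (l : fp_letter G) (w : fp_word G) (A B : {set V}) (x y : Gam).

Definition link : {set V} := [set u | e v u].

Definition lcos x : set Gam := [set y | gpsub link (x^-1 * y)].

Definition ltrans x (q : set Gam) : set Gam := [set y | q (x^-1 * y)].

Lemma ltrans_lcos x y : ltrans x (lcos y) = lcos (x * y).
Proof. by apply/funext => z; rewrite /ltrans /lcos /= invgM mulgA. Qed.

Lemma ltransM x y q : ltrans (x * y) q = ltrans x (ltrans y q).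
Proof. by apply/funext => z; rewrite /ltrans /= invgM mulgA. Qed.

Lemma ltrans1 q : ltrans 1 q = q.
Proof. by apply/funext => z; rewrite /ltrans /= invg1 mul1g. Qed.

Lemma ltransK x : cancel (ltrans x) (ltrans x^-1).
Proof. by move=> q; rewrite -ltransM mulVg ltrans1. Qed.

Lemma ltrans_inj x : injective (ltrans x).
Proof. exact: can_inj (ltransK x). Qed.

Lemma lcosP x y : lcos x = lcos y <-> gpsub link (x^-1 * y).
Proof.
split=> [xy|xy]; first by have : lcos y y; [rewrite /lcos /= mulVg; exact: gpsub1|rewrite -xy].
apply/funext => z; apply/propext; rewrite /lcos /=; split=> Mz.
  by have := gpsubM (gpsubV xy) Mz; rewrite invgM invgK mulgA mulgK.
by have := gpsubM xy Mz; rewrite mulgA mulgK.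
Qed.

Lemma lcos1P x : lcos x = lcos 1 <-> gpsub link x.
Proof.
split=> [/esym/lcosP|Mx]; first by rewrite invg1 mul1g.
by apply/esym/lcosP; rewrite invg1 mul1g.
Qed.

(* The normal form of x relative to v lists its syllables s in G_v, each together with the left
   coset of the subgroup of the link of v that contains the product of the letters outside G_v
   preceding s.  A letter outside G_v translates all cosets; a letter of G_v acts at the trivial
   coset only. *)
Local Notation syllable := (set Gam * G v)%type.
Implicit Types om : seq syllable.

Definition strans x om : seq syllable := [seq (ltrans x p.1, p.2) | p <- om].

Definition insert (s : G v) om : seq syllable :=
  if s == 1 then om else
  if om is p :: om' then
    if p.1 == lcos 1 then
      if s * p.2 == 1 then om' else (lcos 1, s * p.2) :: om'
    else (lcos 1, s) :: om
  else [:: (lcos 1, s)].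

(** Letters at other vertices take the default value 1, so products of [vpart] give the projection
    to G_v. *)
Definition vpart l : G v := tagged_as (Tagged G (1 : G v)) l.

Lemma vpart_letter (g : G v) : vpart (letter g) = g.
Proof. by rewrite /vpart /tagged_as /=; case: eqP => // vv; rewrite [vv]eq_axiomK. Qed.

Lemma letter_vpart l : tag l = v -> letter (vpart l) = l.
Proof. by case: l => u g /= uv; subst u; rewrite vpart_letter. Qed.

Lemma gp_letter_vpart l : tag l = v -> gp_letter e l = gp_in e (vpart l).
Proof. by move=> lv; rewrite -[in LHS](letter_vpart lv). Qed.

Definition vact l om : seq syllable :=
  if tag l == v then insert (vpart l) om else strans (gp_letter e l) om.

(** On these sequences [insert] respects multiplication in G_v: after a cancellation, no further
    syllable at the trivial coset is exposed. [sorted] compares adjacent cosets only, the relation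
    not being transitive. *)
Definition vreduced om : bool :=
  sorted (fun p p' : syllable => p.1 != p'.1) om && all (fun p => p.2 != 1) om.

Lemma strans1 om : strans 1 om = om.
Proof. by rewrite /strans map_id_in // => -[q s] _; rewrite ltrans1. Qed.

Lemma stransM x y om : strans (x * y) om = strans x (strans y om).
Proof. by rewrite /strans -map_comp; apply: eq_map => p /=; rewrite ltransM. Qed.

Lemma size_strans x om : size (strans x om) = size om.
Proof. exact: size_map. Qed.

Lemma strans_reduced x om : vreduced om -> vreduced (strans x om).
Proof.
rewrite /vreduced /strans sorted_map all_map => /andP[so ao]; apply/andP; split=> //.
by apply: sub_sorted so => p p' /=; apply: contra => /eqP/ltrans_inj ->.
Qed.

Lemma insert_reduced s om : vreduced om -> vreduced (insert s om).
Proof.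
rewrite /vreduced /insert; case: eqVneq => //= s1.
case: om => [|[q s'] om] /=; first by rewrite s1.
move=> /and3P[pq s'1 ao]; case: eqVneq => /= [qE|q1]; last by rewrite eq_sym q1 s1 s'1 pq ao.
case: eqVneq => /= [_|ss']; first by rewrite (path_sorted pq).
by rewrite ao ss' !andbT; move: pq; rewrite qE; case: (om).
Qed.

Lemma vact_reduced l om : vreduced om -> vreduced (vact l om).
Proof. by rewrite /vact; case: ifP => _; [exact: insert_reduced|exact: strans_reduced]. Qed.

Lemma insertM g h om : vreduced om -> insert g (insert h om) = insert (g * h) om.
Proof.
rewrite /vreduced /insert.
have [->|g1] := eqVneq g 1; first by rewrite mul1g.
have [->|h1] := eqVneq h 1; first by rewrite mulg1 (negPf g1).
case: om => [|[q s] om] /= => [_|/and3P[pq s1 ao]]; first by rewrite eqxx.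
have [qE|q1] /= := eqVneq q (lcos 1); last by rewrite eqxx.
rewrite -mulgA; have [hs|hs] := eqVneq (h * s) 1.
  rewrite hs mulg1 (negPf g1); move: pq; rewrite qE.
  have gh : (g * h == 1) = (g == s).
    by rewrite mulg_eq1 (mulg1_eq hs).
  rewrite gh; have [gs|gs] := eqVneq g s; case: om {ao} => [|p om] //=.
  - by rewrite gs.
  - by rewrite eq_sym gs => /andP[/negPf ->].
  - by rewrite eq_sym => /andP[/negPf ->].
rewrite /= eqxx; have [gh|gh] := eqVneq (g * h) 1; last by [].
by rewrite mulgA gh mul1g (negPf s1) qE.
Qed.

Lemma vact_rel1 u om : vreduced om -> vact (letter (1 : G u)) om = om.
Proof.
move=> _; rewrite /vact /=; case: eqP => [uv|_]; last by rewrite /gp_letter gp_in1 strans1.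
by subst u; rewrite vpart_letter /insert eqxx.
Qed.
Lemma vact_relM u (g h : G u) om : vreduced om ->
  vact (letter g) (vact (letter h) om) = vact (letter (g * h)) om.
Proof.
move=> rom; rewrite /vact /=; case: eqP => [uv|_].
  by subst u; rewrite !vpart_letter insertM.
by rewrite /gp_letter gp_inM stransM.
Qed.

(** Translation by the link subgroup fixes the trivial coset and, being injective, moves no other
    coset onto it. *)
Lemma strans_insert x s om : gpsub link x -> strans x (insert s om) = insert s (strans x om).
Proof.
move=> Mx; rewrite /insert; case: eqP => // _.
have x1 : ltrans x (lcos 1) = lcos 1 by rewrite ltrans_lcos mulg1; exact/lcos1P.
case: om => [|[q s'] om] /=; first by rewrite x1.
have -> : (ltrans x q == lcos 1) = (q == lcos 1) by rewrite -{1}x1 (inj_eq (@ltrans_inj x)).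
by case: ifP => _; [case: ifP => _|]; rewrite /= ?x1.
Qed.

Lemma gp_letter_sub A l : tag l \in A -> gpsub A (gp_letter e l).
Proof.
move=> lA; have : gpsub A (gpw e [:: l]) by apply: gpw_sub; rewrite /= lA.
by rewrite gpw_cons gpw_nil mulg1.
Qed.

Lemma vact_relC u u' (g : G u) (h : G u') om : e u u' -> vreduced om ->
  vact (letter g) (vact (letter h) om) = vact (letter h) (vact (letter g) om).
Proof.
move=> euu' _; rewrite /vact /=.
case: eqP => [uv|_]; case: eqP => [u'v|_]; first by subst u u'; rewrite e_irr in euu'.
- by rewrite strans_insert //; apply: gp_letter_sub; rewrite inE /= -uv.
- by rewrite strans_insert //; apply: gp_letter_sub; rewrite inE /= -u'v e_sym.
- by rewrite -!stransM /gp_letter gp_inC.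
Qed.

Definition vnf w := foldr vact [::] w.

Definition vcount w := count [pred l | tag l == v] w.

Definition gact x om := foldr vact om (gp_word x).

Lemma foldr_vact_reduced w om : vreduced om -> vreduced (foldr vact om w).
Proof. by move=> rom; elim: w => //= l w; exact: vact_reduced. Qed.

Lemma gact_gpw w om : vreduced om -> gact (gpw e w) om = foldr vact om w.
Proof.
apply: (gpw_act (D := fun om => vreduced om)) => [l om'||||].
- exact: vact_reduced.
- by move=> u om'; exact: vact_rel1.
- by move=> u g h om'; exact: vact_relM.
- by move=> u u' g h om'; exact: vact_relC.
- exact: gp_wordK.
Qed.

Lemma gact_reduced x om : vreduced om -> vreduced (gact x om).
Proof. exact: foldr_vact_reduced. Qed.

Lemma gactM x y om : vreduced om -> gact (x * y) om = gact x (gact y om).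
Proof.
move=> rom; rewrite -(gp_wordK x) -(gp_wordK y) -gpw_cat !gact_gpw ?foldr_cat //.
exact: foldr_vact_reduced.
Qed.

Lemma vnf_gact w : vnf w = gact (gpw e w) [::].
Proof. by rewrite gact_gpw. Qed.

Lemma insert_eq s om : size (insert s om) = (size om).+1 ->
  insert s om = (lcos 1, s) :: om /\ s != 1.
Proof.
rewrite /insert; case: eqVneq => [_ /n_Sn|s1] //.
case: om => // p om; case: eqP => // p1; case: eqP => ss /=; last by move=> /n_Sn.
by move=> /eqP; rewrite -[X in X == _]addn0 -addn2 eqn_add2l.
Qed.

Lemma insert_nil s : s != 1 -> insert s [::] = [:: (lcos 1, s)].
Proof. by rewrite /insert => /negPf ->. Qed.

Lemma insert_cons s q s' om : s != 1 -> q != lcos 1 ->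
  insert s ((q, s') :: om) = (lcos 1, s) :: (q, s') :: om.
Proof. by rewrite /insert /= => /negPf -> /negPf ->. Qed.

Lemma size_insert s om : (size (insert s om) <= (size om).+1)%N.
Proof.
rewrite /insert; case: eqP => [_|s1] //; case: om => [|p om] //.
by case: eqP => [_|_] //; case: eqP => //= _; rewrite ?leqW.
Qed.

Lemma insert_short s om : (size (insert s om) <= size om)%N ->
  s = 1 \/ exists s' om', om = (lcos 1, s') :: om'.
Proof.
rewrite /insert; case: eqVneq => [->|s1]; first by left.
case: om => [|[q s'] om] //; case: eqVneq => /= [->|_]; last by rewrite ltnn.
by right; exists s', om.
Qed.

Lemma size_foldr_vact w om : (size (foldr vact om w) <= size om + vcount w)%N.
Proof.
elim: w => [|l w IHw] /=; first by rewrite addn0.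
rewrite {1}/vact; case: eqP => _ /=; last by rewrite size_strans.
by rewrite addnCA add1n; apply: leq_trans (size_insert _ _) _; rewrite ltnS.
Qed.

Lemma retr_v_cons l w : retr [set~ v] (gpw e (l :: w)) =
  (if tag l == v then 1 else gp_letter e l) * retr [set~ v] (gpw e w).
Proof.
rewrite !retr_gpw /= !inE; case: eqP => _ /=; first by rewrite mul1g.
by rewrite gpw_cons.
Qed.

(** If every letter at v adds a syllable, nothing merges with om, which is only translated. Letters
    at v translate nothing, so the translation is by the product of the other letters. *)
Lemma foldr_vact_full w om : size (foldr vact om w) = (size om + vcount w)%N ->
  size (vnf w) = vcount w /\
  foldr vact om w = vnf w ++ strans (retr [set~ v] (gpw e w)) om.
Proof.
elim: w => [|l w IHw] /=; first by rewrite gpw_nil retr1 strans1.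
have szw := size_foldr_vact w om.
rewrite retr_v_cons /vcount /= -/(vcount w) /vact; case: eqP => lv /=.
  rewrite add1n addnS => szl; rewrite mul1g.
  have szE : size (foldr vact om w) = (size om + vcount w)%N.
    apply/eqP; rewrite eqn_leq szw -ltnS -szl; exact: size_insert.
  have [nw wE] := IHw szE; rewrite -/vact.
  have [insE s1] : insert (vpart l) (foldr vact om w) = (lcos 1, vpart l) :: foldr vact om w
      /\ vpart l != 1 by apply: insert_eq; rewrite szl szE.
  move: insE; rewrite wE; rewrite -/(vnf w); case: (vnf w) nw => [|p nf] nw /=.
    by rewrite insert_nil //= -nw.
  (* [insert] inspects only the first syllable, which here belongs to [vnf w]; hence no merging
     occurs there either. *)
  rewrite /insert (negPf s1) /=; case: ifP => _ /=; last by rewrite -nw.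
  case: ifP => _ /(congr1 size) /=; last by move=> /n_Sn.
  by move/eqP; rewrite -[X in X == _]addn0 -addn2 eqn_add2l.
rewrite add0n size_strans => /IHw[nw wE]; rewrite size_strans; split=> //.
by rewrite wE stransM /strans map_cat.
Qed.

End VertexAction.

(** * Reduced words and word length *)

Section WordLength.
Variables (G : groupType) (X : genset G).
Implicit Types g h : G.

Lemma word_lengthP g : exists w : seq G,
  [/\ forall x, x \in w -> gens X x, size w = word_length X g & \prod_(x <- w) x = g].
Proof. by rewrite /word_length; case: ex_minnP => n /asboolP. Qed.

Lemma word_length_le (w : seq G) : (forall x, x \in w -> gens X x) ->
  (word_length X (\prod_(x <- w) x) <= size w)%N.
Proof.
move=> wX; rewrite /word_length; case: ex_minnP => n _; apply; apply/asboolP.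
by exists w.
Qed.

Lemma word_length1 : word_length X 1 = 0.
Proof. by have := @word_length_le [::]; rewrite big_nil leqn0 => /(_ _)/eqP; exact. Qed.

Lemma word_length_eq0 g : word_length X g = 0 -> g = 1.
Proof. by have [w [_ <- <-]] := word_lengthP g => /size0nil ->; rewrite big_nil. Qed.

Lemma word_lengthM g h : (word_length X (g * h) <= word_length X g + word_length X h)%N.
Proof.
have [w [wX <- <-]] := word_lengthP g; have [u [uX <- <-]] := word_lengthP h.
rewrite -big_cat -size_cat; apply: word_length_le => x.
by rewrite mem_cat => /orP[/wX|/uX].
Qed.

Lemma word_length_gen g : gens X g -> (word_length X g <= 1)%N.
Proof.
move=> Xg; have := @word_length_le [:: g]; rewrite big_seq1; apply.
by move=> x; rewrite inE => /eqP ->.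
Qed.

Lemma word_lengthV g : word_length X g^-1 = word_length X g.
Proof.
suff le h : (word_length X h^-1 <= word_length X h)%N.
  by apply/eqP; rewrite eqn_leq le /= -[in X in (X <= _)%N](invgK g) le.
have [w [wX <- <-]] := word_lengthP h.
rewrite -[in X in (X <= _)%N](revK w) -prodgV -(size_rev w).
rewrite -(size_map (fun x : G => x^-1)) -(big_map (fun x : G => x^-1) predT id).
by apply: word_length_le => y /mapP[x]; rewrite mem_rev => /wX Xx ->; exact: gensV.
Qed.

End WordLength.

Section ReducedWords.
Variables (V : finType) (e : rel V) (G : V -> groupType).
Hypotheses (e_sym : symmetric e) (e_irr : irreflexive e).
Variable X : forall v, genset (G v).
Local Notation Gam := (graph_product e G).
Implicit Types (l : fp_letter G) (w : fp_word G) (A B : {set V}) (x y : Gam) (v : V).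

Lemma vcount_cat v w w' : vcount v (w ++ w') = (vcount v w + vcount v w')%N.
Proof. exact: count_cat. Qed.

Lemma novcount v w : vcount v w = 0 ->
  forall om, foldr (@vact _ e _ v) om w = strans (gpw e w) om.
Proof.
elim: w => [|l w IHw] /=; first by move=> _ om; rewrite gpw_nil strans1.
rewrite /vcount /= -/(vcount v w) {1}/vact; case: eqP => //= _ c0 om.
by rewrite IHw // gpw_cons stransM.
Qed.

Lemma vcount_split v w : (0 < vcount v w)%N -> exists w1 l w2,
  [/\ w = w1 ++ l :: w2, tag l = v & vcount v w1 = 0].
Proof.
elim: w => [|l w IHw] //=; rewrite /vcount /= -/(vcount v w); case: eqP => [lv _|lv].
  by exists [::], l, w.
by move=> /IHw[w1 [l1 [w2 [-> l1v c0]]]]; exists (l :: w1), l1, w2; split=> //=; case: eqP.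
Qed.

Lemma vnf_cons v l w : vnf e v (l :: w) = vact l (vnf e v w).
Proof. by []. Qed.

(** Reducedness as seen from v: no letter at v is trivial or can be shuffled next to another one and
    merged with it. *)
Definition vfull v w := size (vnf e v w) == vcount v w.

(** Neither part can produce more syllables than it has letters at v, so equality for the whole
    forces equality for both. *)
Lemma vfull_cat v w w' : vfull v (w ++ w') -> vfull v w /\ vfull v w'.
Proof.
rewrite /vfull /vnf foldr_cat vcount_cat => /eqP sz.
have sz1 := size_foldr_vact (e := e) w (vnf e v w').
have sz2 := size_foldr_vact (e := e) w' ([::] : seq (set Gam * G v)).
rewrite -/(vnf e v w') /= add0n in sz2.
have szw' : size (vnf e v w') = vcount v w'.
  by apply/eqP; rewrite eqn_leq sz2 -(leq_add2l (vcount v w)) -sz addnC.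
split; apply/eqP => //.
by apply: (proj1 (foldr_vact_full (om := vnf e v w') _)); rewrite sz szw' addnC.
Qed.

Lemma link_comm v (g : G v) x : gpsub (link e v) x -> x * gp_in e g = gp_in e g * x.
Proof.
move=> /gpsubP[w wl <-]; elim: w wl => [|l w IHw] /=; first by rewrite gpw_nil mul1g mulg1.
rewrite inE => /andP[evl /IHw E].
by rewrite gpw_cons -mulgA E !mulgA /gp_letter (gp_inC _ _ evl).
Qed.

Lemma vfull_cons v l w : tag l = v -> vfull v (l :: w) ->
  vnf e v (l :: w) = (lcos v 1, vpart v l) :: vnf e v w /\ vpart v l != 1.
Proof.
move=> lv ful; have [_ /eqP wful] := vfull_cat (w := [:: l]) ful.
have E : vnf e v (l :: w) = insert (vpart v l) (vnf e v w) by rewrite vnf_cons /vact lv eqxx.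
move: ful; rewrite /vfull E /vcount /= -/(vcount v w) lv eqxx -wful add1n => /eqP.
exact: insert_eq.
Qed.

(** An insertion that adds no syllable comes from a trivial letter, or meets a first syllable at the
    trivial coset. In the latter case the letters before that syllable multiply to an element of the
    link subgroup, which commutes with G_v, so the two letters at v can be merged. *)
Lemma not_vfull_shorten v w : ~~ vfull v w -> exists2 w', gpw e w' = gpw e w & (size w' < size w)%N.
Proof.
elim: w => [|l w IHw] // nful.
have [wful|/IHw[w' w'E szw']] := boolP (vfull v w); last first.
  by exists (l :: w'); rewrite ?gpw_cons ?w'E.
move: nful; rewrite /vfull vnf_cons /vcount /= -/(vcount v w) /vact.
case: (tag l =P v) => [lv|_] /=;
  last by rewrite size_strans add0n; move: wful; rewrite /vfull => ->.
rewrite -(eqP wful) add1n => nful.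
have : (size (insert (vpart v l) (vnf e v w)) <= size (vnf e v w))%N.
  by rewrite -ltnS ltn_neqAle nful size_insert.
move=> /insert_short[l1|[s' [om' nfE]]].
  by exists w => //; rewrite gpw_cons (gp_letter_vpart e lv) l1 gp_in1 mul1g.
have : (0 < vcount v w)%N by rewrite -(eqP wful) nfE.
move=> /vcount_split[w1 [l1 [w2 [wE l1v c0]]]].
have [_ ful2] : vfull v w1 /\ vfull v (l1 :: w2) by apply: vfull_cat; rewrite -wE.
have [nf2 _] := vfull_cons l1v ful2.
have w1M : gpsub (link e v) (gpw e w1).
  move: nfE; rewrite wE /vnf foldr_cat novcount // -/(vnf e v _) nf2 /= => -[+ _ _].
  by rewrite ltrans_lcos mulg1 => /lcos1P.
exists (letter (vpart v l * vpart v l1) :: w1 ++ w2); last first.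
  by rewrite wE /= !size_cat /= addnS.
rewrite wE !gpw_cons !gpw_cat gpw_cons (gp_letter_vpart e lv) (gp_letter_vpart e l1v).
rewrite /gp_letter /= gp_inM -mulgA; congr (_ * _).
by rewrite !mulgA -(link_comm (vpart v l1) w1M).
Qed.

Definition reduced w := forall v, vfull v w.

Lemma reduced_exists w : exists2 w', gpw e w' = gpw e w & reduced w'.
Proof.
have [n] := ubnP (size w); elim: n w => // n IHn w; rewrite ltnS => szw.
have [rw|/existsNP[v /negP/not_vfull_shorten[w' <- szw']]] := pselect (reduced w).
  by exists w.
by apply: IHn; exact: leq_trans szw.
Qed.

Lemma reduced_cat w w' : reduced (w ++ w') -> reduced w /\ reduced w'.
Proof. by move=> r; split=> v; have [] := vfull_cat (r v). Qed.

(** The number of syllables is an invariant of the element and is at most the number of letters at v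
    in any word for it. *)
Lemma vcount_vnf v w w' : gpw e w = gpw e w' -> vfull v w -> (vcount v w <= vcount v w')%N.
Proof.
move=> E /eqP <-; rewrite vnf_gact // E -vnf_gact //.
exact: size_foldr_vact.
Qed.

Lemma vcount_eq0 v w : (vcount v w == 0) = all [pred l | tag l != v] w.
Proof. by rewrite eqn0Ngt -has_count -all_predC. Qed.

(** Deleting the letters outside A yields another word for the same element, and a reduced word has
    the fewest letters at each vertex. *)
Lemma reduced_sub A w : reduced w -> gpsub A (gpw e w) -> all [pred l | tag l \in A] w.
Proof.
move=> rw; rewrite /gpsub /= retr_gpw => E; apply/allP => l lw /=; apply: contraT => lA.
have := vcount_vnf (esym E) (rw (tag l)).
have -> : vcount (tag l) [seq l <- w | tag l \in A] = 0.
  apply/eqP; rewrite vcount_eq0; apply/allP => l'; rewrite mem_filter => /andP[l'A _] /=.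
  by apply: contra lA => /eqP <-.
by rewrite leqn0 vcount_eq0 => /allP/(_ _ lw)/=; rewrite eqxx.
Qed.

(* Being reduced only depends on the value and on the vertex counts of a word. *)
Lemma reduced_perm w w' : perm_eq w w' -> gpw e w = gpw e w' -> reduced w -> reduced w'.
Proof.
move=> /permP pww E rw v; move/eqP: (rw v); rewrite /vfull vnf_gact // E -vnf_gact // => ->.
by rewrite /vcount pww.
Qed.

Local Notation len := (word_length (gp_genset e X)).

Definition letter_length l := word_length (X (tag l)) (tagged l).

Definition word_weight w := (\sum_(l <- w) letter_length l)%N.

Definition syl_weight v (om : seq (set Gam * G v)) := (\sum_(p <- om) word_length (X v) p.2)%N.

Lemma letter_lengthE v l : tag l = v -> letter_length l = word_length (X v) (vpart v l).
Proof. by move=> lv; rewrite -[in LHS](letter_vpart lv). Qed.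

Lemma syl_weight_insert v s (om : seq (set Gam * G v)) :
  (syl_weight (insert s om) <= word_length (X v) s + syl_weight om)%N.
Proof.
rewrite /insert; case: eqVneq => [->|s1]; first exact: leq_addl.
case: om => [|[q s'] om]; first by rewrite /syl_weight big_cons big_nil.
case: eqVneq => q1; rewrite /syl_weight /= !big_cons //=.
case: eqVneq => ss'; first by rewrite addnA leq_addl.
by rewrite big_cons /= addnA leq_add2r word_lengthM.
Qed.

Lemma syl_weight_strans v x (om : seq (set Gam * G v)) :
  syl_weight (strans x om) = syl_weight om.
Proof. by rewrite /syl_weight big_map. Qed.

Lemma syl_weight_vnf v w :
  (syl_weight (vnf e v w) <= \sum_(l <- w | tag l == v) letter_length l)%N.
Proof.
elim: w => [|l w IHw]; first by rewrite /syl_weight !big_nil.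
rewrite big_cons vnf_cons /vact; case: eqP => lv; last by rewrite syl_weight_strans.
apply: leq_trans (syl_weight_insert _ _) _.
by rewrite (letter_lengthE lv) leq_add2l.
Qed.

Lemma syl_weight_vfull v w : vfull v w ->
  syl_weight (vnf e v w) = (\sum_(l <- w | tag l == v) letter_length l)%N.
Proof.
elim: w => [|l w IHw] ful; first by rewrite /syl_weight !big_nil.
have [_ /IHw wE] := vfull_cat (w := [:: l]) ful.
rewrite big_cons -wE; case: eqP => lv.
  by have [-> _] := vfull_cons lv ful; rewrite /syl_weight big_cons (letter_lengthE lv).
by rewrite vnf_cons /vact; case: eqP => // _; rewrite syl_weight_strans.
Qed.

Lemma gen_word x : exists2 w, gpw e w = x & (word_weight w <= len x)%N.
Proof.
have [w [wX <- <-]] := word_lengthP (gp_genset e X) x.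
elim: w wX => [|y w IHw] wX; first by exists [::]; rewrite /word_weight ?gpw_nil !big_nil.
have [|w' w'E w'le] := IHw; first by move=> z zw; apply: wX; rewrite inE zw orbT.
have [v _ [g Xg gE]] : gp_gens X y by apply: wX; rewrite mem_head.
exists (letter g :: w'); first by rewrite gpw_cons big_cons w'E -gE.
rewrite /word_weight big_cons /= -add1n leq_add // /letter_length /=.
exact: word_length_gen.
Qed.

Lemma len_letter l : (len (gp_letter e l) <= letter_length l)%N.
Proof.
have [w [wX sw wE]] := word_lengthP (X (tag l)) (tagged l).
have -> : gp_letter e l = \prod_(x <- map (@gp_in _ e G (tag l)) w) x.
  rewrite big_map /gp_letter -wE; elim: (w) => [|y u IHu]; first by rewrite !big_nil gp_in1.
  by rewrite !big_cons gp_inM IHu.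
rewrite /letter_length -sw -(size_map (@gp_in _ e G (tag l))); apply: word_length_le.
by move=> _ /mapP[y /wX Xy ->]; exists (tag l) => //; exists y.
Qed.

Lemma len_gpw w : (len (gpw e w) <= word_weight w)%N.
Proof.
rewrite /word_weight; elim: w => [|l w IHw]; first by rewrite gpw_nil word_length1.
rewrite gpw_cons big_cons; apply: leq_trans (word_lengthM _ _ _) _.
by rewrite leq_add // len_letter.
Qed.

Lemma word_weight_sum w : word_weight w = (\sum_v \sum_(l <- w | tag l == v) letter_length l)%N.
Proof.
rewrite /word_weight (exchange_big_dep predT) //=; apply: eq_bigr => l _.
by rewrite (big_pred1 (tag l)) // => v; rewrite eq_sym.
Qed.

(** For the lower bound, the total length of the syllables at each vertex depends only on the
    element. A reduced word attains it, and merging never raises it, so it is at most the weight of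
    the word read off a geodesic. *)
Lemma len_reduced w : reduced w -> len (gpw e w) = word_weight w.
Proof.
move=> rw; apply/eqP; rewrite eqn_leq len_gpw /=.
have [w' w'E] := gen_word (gpw e w); apply: leq_trans.
rewrite !word_weight_sum; apply: leq_sum => v _.
rewrite -syl_weight_vfull // vnf_gact // -w'E -vnf_gact //.
exact: syl_weight_vnf.
Qed.

Lemma reduced_word x : exists w, [/\ gpw e w = x, reduced w & word_weight w = len x].
Proof.
have [w wE] := gpw_surj x; have [w' w'E rw'] := reduced_exists w.
by exists w'; split=> //; rewrite -?len_reduced // w'E wE.
Qed.

End ReducedWords.

(** * Shortest coset representatives *)

Section Gates.
Variables (V : finType) (e : rel V) (G : V -> groupType).
Hypotheses (e_sym : symmetric e) (e_irr : irreflexive e).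
Variable X : forall v, genset (G v).
Local Notation Gam := (graph_product e G).
Local Notation len := (word_length (gp_genset e X)).
Implicit Types (l : fp_letter G) (w : fp_word G) (A L : {set V}) (x y t h : Gam) (v : V).

(** For the shortest suffix l :: c that fails to concatenate with a, the letter l merges with a
    letter at its own vertex. As l :: c is reduced, that letter lies in a, and it can be shuffled to
    the front of a. *)
Lemma not_reduced_cat L a c : reduced e a -> reduced e c -> all [pred l | tag l \in L] c ->
  ~ reduced e (c ++ a) -> exists a1 l a2,
  [/\ a = a1 ++ l :: a2, tag l \in L & all [pred l' | tag l' \in link e (tag l)] a1].
Proof.
move=> ra; elim: c => [|l c IHc] //= rlc /andP[lL cL] nr.
have [_ rc] := reduced_cat (w := [:: l]) rlc.
have [rca|/(IHc rc cL)//] := pselect (reduced e (c ++ a)).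
have [v /negP nv] : exists v, ~ vfull e v (l :: c ++ a) by exact/existsNP.
have fca := rca v; move: nv; rewrite /vfull vnf_cons /vcount /= -/(vcount v (c ++ a)) /vact.
case: (tag l =P v) => [lv|_] /=; last first.
  by rewrite size_strans add0n; move: fca; rewrite /vfull => ->.
rewrite -(eqP fca) add1n => ns.
have [nfl s1] := vfull_cons lv (rlc v).
have : (size (insert (vpart v l) (vnf e v (c ++ a))) <= size (vnf e v (c ++ a)))%N.
  by rewrite -ltnS ltn_neqAle ns size_insert.
move=> /insert_short[sE|[s' [om' nfE]]]; first by rewrite sE eqxx in s1.
(* A letter at v in c would put the first syllable of [vnf e v c] at the trivial coset, giving l ::
   c two successive syllables there. *)
have [c0|c0] := posnP (vcount v c); last first.
  have [_ caE] : size (vnf e v c) = vcount v c /\ vnf e v (c ++ a) =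
      vnf e v c ++ strans (retr [set~ v] (gpw e c)) (vnf e v a).
    rewrite {2}/vnf foldr_cat; apply: foldr_vact_full; rewrite -foldr_cat.
    rewrite -/(vnf e v _) (eqP fca) vcount_cat addnC; congr (_ + _)%N.
    by apply/esym/eqP; exact: ra.
  have : vreduced (vnf e v (l :: c)) by exact: foldr_vact_reduced.
  have := eqP (rc v); rewrite nfl; move: nfE; rewrite caE.
  case: (vnf e v c) => [|p om] /=; first by move=> _ c0'; rewrite -c0' in c0.
  by case=> -> _ _ /andP[/andP[]]; rewrite eqxx.
have a0 : (0 < vcount v a)%N by move: (eqP fca); rewrite vcount_cat c0 add0n => <-; rewrite nfE.
have [a1 [l1 [a2 [aE l1v a10]]]] := vcount_split a0.
exists a1, l1, a2; split=> //; first by rewrite l1v -lv.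
have [_ fl1] : vfull e v a1 /\ vfull e v (l1 :: a2) by apply: vfull_cat; rewrite -aE.
have [nf1 _] := vfull_cons l1v fl1.
have M1 : gpsub (link e v) (gpw e (c ++ a1)).
  move: nfE; rewrite aE catA /vnf foldr_cat novcount; last by rewrite vcount_cat c0.
  by rewrite -/(vnf e v _) nf1 /= => -[+ _ _]; rewrite ltrans_lcos mulg1 => /lcos1P.
have [rca1 _] : reduced e (c ++ a1) /\ reduced e (l1 :: a2).
  by apply: reduced_cat; rewrite -catA -aE.
by have := reduced_sub e_sym e_irr rca1 M1; rewrite l1v all_cat => /andP[].
Qed.

(** Letters of L that can be shuffled to the front of a are moved to b as long as there are any.
    When this stops, every reduced word over L followed by a is reduced, by [not_reduced_cat], so
    lengths add. *)
Lemma left_gate A L y : gpsub A y -> exists h t,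
  [/\ y = h * t, gpsub (A :&: L) h, gpsub A t, len y = (len h + len t)%N &
      forall h', gpsub L h' -> len (h' * t) = (len h' + len t)%N].
Proof.
move=> Ay; have [w [wE rw _]] := reduced_word e_sym e_irr X y.
have wA : all [pred l | tag l \in A] w.
  by apply: (reduced_sub e_sym e_irr) => //; rewrite wE.
suff main n a b : (size a < n)%N -> reduced e (b ++ a) -> all [pred l | tag l \in L] b ->
    all [pred l | tag l \in A] (b ++ a) -> gpw e (b ++ a) = y -> exists h t,
    [/\ y = h * t, gpsub (A :&: L) h, gpsub A t, len y = (len h + len t)%N &
      forall h', gpsub L h' -> len (h' * t) = (len h' + len t)%N].
  exact: (main _ w [::] (ltnSn _)).
elim: n a b => // n IHn a b; rewrite ltnS => san rba bL baA baE.
have [rb ra] := reduced_cat rba.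
have [[c [rc cL nr]]|allc] := pselect (exists c,
    [/\ reduced e c, all [pred l | tag l \in L] c & ~ reduced e (c ++ a)]).
  have [a1 [l [a2 [aE lL a1l]]]] := not_reduced_cat ra rc cL nr.
  have la1 := link_comm (tagged l) (gpw_sub e a1l).
  have perm : perm_eq (b ++ a) ((b ++ [:: l]) ++ a1 ++ a2).
    by rewrite aE -catA perm_cat2l /= -cat1s perm_catCA.
  have pE : gpw e (b ++ a) = gpw e ((b ++ [:: l]) ++ a1 ++ a2).
    by rewrite aE !gpw_cat !gpw_cons gpw_nil mulg1 -!mulgA; congr (_ * _); rewrite !mulgA la1.
  apply: (IHn (a1 ++ a2) (b ++ [:: l])).
  - by apply: leq_trans san; rewrite aE !size_cat /= addnS.
  - exact: reduced_perm perm pE rba.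
  - by rewrite all_cat bL /= lL.
  - by rewrite -(perm_all _ perm).
  - by rewrite -pE.
move: (baA); rewrite all_cat => /andP[bA aA].
exists (gpw e b), (gpw e a); split.
- by rewrite -baE gpw_cat.
- by apply: gpsubI; exact: gpw_sub.
- exact: gpw_sub.
- by rewrite -baE !len_reduced // /word_weight big_cat.
move=> h' Lh'; have [c [cE rc _]] := reduced_word e_sym e_irr X h'.
have cL : all [pred l | tag l \in L] c.
  by apply: (reduced_sub e_sym e_irr) => //; rewrite cE.
have rca : reduced e (c ++ a) by apply: contrapT => nr; apply: allc; exists c.
by rewrite -cE -gpw_cat !len_reduced // /word_weight big_cat.
Qed.

(* t is the shortest element of its left coset of G_L. *)
Definition gate L t := forall h, gpsub L h -> len (t * h) = (len t + len h)%N.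

Lemma gateP A L y : gpsub A y -> exists t h,
  [/\ y = t * h, gpsub A t, gpsub (A :&: L) h, len y = (len t + len h)%N & gate L t].
Proof.
move=> /gpsubV/(left_gate L)[h [t [yE Lh At leny gt]]].
exists t^-1, h^-1; split; try exact: gpsubV.
- by rewrite -invgM -yE invgK.
- by rewrite !word_lengthV addnC -leny word_lengthV.
move=> h' Lh'; rewrite -word_lengthV invgM invgK gt ?word_lengthV 1?addnC //.
exact: gpsubV.
Qed.

(** With t' = t h, the gate properties give len t' = len t + len h and len t = len t' + len h, so h
    has length 0. *)
Lemma gate_inj L t t' : gate L t -> gate L t' -> gpsub L (t^-1 * t') -> t = t'.
Proof.
move=> gt gt' Lh.
have := gt _ Lh; rewrite mulVKg => E.
have := gt' _ (gpsubV Lh); rewrite word_lengthV E.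
rewrite (_ : t' * _ = t); last by rewrite invgM invgK mulVKg.
move=> /eqP; rewrite -addnA -[X in X == _]addn0 eqn_add2l eq_sym addn_eq0.
move=> /andP[/eqP/word_length_eq0 h1 _].
by rewrite -[t]mulg1 -h1 mulVKg.
Qed.

Lemma gate_sub L t : gate L t -> gpsub L t -> t = 1.
Proof.
move=> gt /gpsubV/gt; rewrite mulgV word_length1 => /esym/eqP.
by rewrite addn_eq0 => /andP[/eqP/word_length_eq0].
Qed.

(** The projection [retr [set v]], but with values in the type [G v]. *)
Definition vretr v x : G v := \prod_(l <- gp_word x) vpart v l.

Lemma vpart_neq v l : tag l != v -> vpart v l = 1.
Proof. by rewrite /vpart /tagged_as /= => /eqP lv; case: eqP => // vl; case: lv. Qed.

Lemma vretr_gpw v w : vretr v (gpw e w) = \prod_(l <- w) vpart v l.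
Proof.
pose a l (g : G v) := vpart v l * g.
have aE w' : foldr a 1 w' = \prod_(l <- w') vpart v l.
  by elim: w' => [|l w' /= ->]; rewrite ?big_nil // big_cons.
rewrite /vretr -!aE; apply: (gpw_act (D := fun=> True)) => //; last exact: gp_wordK.
- move=> u t _; rewrite /a; have [uv|uv] := eqVneq u v; last by rewrite vpart_neq ?mul1g.
  by subst u; rewrite vpart_letter mul1g.
- move=> u g h t _; rewrite /a; have [uv|uv] := eqVneq u v; last by rewrite !vpart_neq ?mul1g.
  by subst u; rewrite !vpart_letter mulgA.
- move=> u u' g h t euu' _; rewrite /a.
  have [uv|uv] := eqVneq u v; last by rewrite (@vpart_neq _ (letter g)) ?mul1g.
  rewrite (@vpart_neq _ (letter h)) ?mul1g //.
  by apply: contraTneq euu' => /= ->; rewrite uv e_irr.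
Qed.

Lemma vretrM v x y : vretr v (x * y) = vretr v x * vretr v y.
Proof. by rewrite -(gp_wordK x) -(gp_wordK y) -gpw_cat !vretr_gpw big_cat. Qed.

Lemma vretrV v x : vretr v x^-1 = (vretr v x)^-1.
Proof.
apply: (mulIg (vretr v x)); rewrite -vretrM !mulVg.
by rewrite -(gpw_nil e G) vretr_gpw big_nil.
Qed.

Lemma gpw_letter v (g : G v) : gpw e [:: letter g] = gp_in e g.
Proof. by rewrite gpw_cons gpw_nil mulg1. Qed.

Lemma vretr_in v (g : G v) : vretr v (gp_in e g) = g.
Proof. by rewrite -gpw_letter vretr_gpw big_seq1 vpart_letter. Qed.

Lemma len_vretr v x : (word_length (X v) (vretr v x) <= len x)%N.
Proof.
have [w <- /(leq_trans _)] := gen_word X x; apply.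
rewrite vretr_gpw; elim: w => [|l w IHw]; first by rewrite big_nil word_length1.
rewrite /word_weight !big_cons; apply: leq_trans (word_lengthM _ _ _) _; apply: leq_add => //.
have [lv|lv] := eqVneq (tag l) v; last by rewrite vpart_neq // word_length1.
by rewrite (letter_lengthE X lv).
Qed.

(** The embedding is isometric because its left inverse [vretr] does not increase length. *)
Lemma len_in v (g : G v) : len (gp_in e g) = word_length (X v) g.
Proof.
apply/eqP; rewrite eqn_leq [X in X && _](len_letter e X (letter g)) /=.
by rewrite -[g in (word_length _ g <= _)%N](vretr_in g) len_vretr.
Qed.

End Gates.

(** * Conjugacy of block words *)

Section BlockWords.
Variables (V : finType) (e : rel V) (G : V -> groupType).
Hypotheses (e_sym : symmetric e) (e_irr : irreflexive e).
Local Notation Gam := (graph_product e G).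
Variable v : V.
Local Notation syllable := (set Gam * G v)%type.
Local Notation block := (Gam * G v)%type.
Local Notation act := (@gact V e G v).
Local Notation vproj := (retr [set~ v]).
Implicit Types (x y z t : Gam) (om : seq syllable) (b c : seq block) (n i j k : nat).

Lemma gact1 om : vreduced om -> act 1 om = om.
Proof. by move=> rom; rewrite -(gpw_nil e G) gact_gpw. Qed.

Lemma gact_strans t om : gpsub [set~ v] t -> vreduced om -> act t om = strans t om.
Proof.
move=> /gpsubP[w wv <-] rom; rewrite gact_gpw // novcount //.
by apply/eqP; rewrite vcount_eq0; apply: sub_all wv => l; rewrite /= !inE.
Qed.

Lemma gact_in (g : G v) om : vreduced om -> act (gp_in e g) om = insert g om.
Proof.
by move=> rom; rewrite -gpw_letter gact_gpw //= /vact /= eqxx vpart_letter.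
Qed.

Lemma gact_full x om : vreduced om ->
  (size (act x om) <= size om + size (act x [::]))%N /\
  (size (act x om) = (size om + size (act x [::]))%N ->
    act x om = act x [::] ++ strans (vproj x) om).
Proof.
move=> rom; have [w0 w0E] := gpw_surj x.
have [w wE rw] := reduced_exists e w0.
rewrite -{}w0E -{}wE !gact_gpw // -/(vnf e v w) (eqP (rw v)).
by split=> [|/foldr_vact_full[_ ->]//]; exact: size_foldr_vact.
Qed.

Lemma insert_local (s : G v) om : exists (pre : seq syllable) k,
  [/\ (size pre <= 1)%N, (k <= 1)%N & insert s om = pre ++ drop k om].
Proof.
rewrite /insert; case: eqP => _; first by exists [::], 0; rewrite drop0.
case: om => [|p om]; first by exists [:: (lcos v 1, s)], 0.
case: eqP => _; last by exists [:: (lcos v 1, s)], 0.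
case: eqP => _; first by exists [::], 1%N; rewrite /= drop0.
by exists [:: (lcos v 1, s * p.2)], 1%N; rewrite /= drop0.
Qed.

(** Each letter alters at most one leading syllable, so deep inside a long sequence x is seen only
    as a translation, uniformly in om. *)
Lemma gact_local x : exists n, forall om, vreduced om -> exists (pre : seq syllable) k,
  [/\ (size pre <= n)%N, (k <= n)%N & act x om = pre ++ strans (vproj x) (drop k om)].
Proof.
have [w <-] := gpw_surj x; exists (vcount v w) => om rom; rewrite gact_gpw //.
elim: w => [|l w [pre [k [szp kn E]]]].
  by exists [::], 0; rewrite gpw_nil retr1 strans1 drop0.
rewrite retr_v_cons /= E /vact /vcount /= -/(vcount v w); case: eqP => lv /=; last first.
  exists (strans (gp_letter e l) pre), k.
  by rewrite size_strans stransM /strans map_cat.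
rewrite mul1g add1n; set z := vproj _.
have [pre' [k' [szp' k'1 ->]]] := insert_local (vpart v l) (pre ++ strans z (drop k om)).
rewrite drop_cat; case: ltnP => kp.
  exists (pre' ++ drop k' pre), k; rewrite catA; split=> //; last exact: leqW.
  by rewrite size_cat size_drop; apply: (leq_add szp'); exact: leq_trans (leq_subr _ _) szp.
exists pre', (k' - size pre + k)%N; split.
- exact: leq_trans szp' _.
- by rewrite -add1n leq_add // (leq_trans (leq_subr _ _)).
- by rewrite /strans -map_drop drop_drop.
Qed.

Definition block_prod b : Gam := \prod_(p <- b) (p.1 * gp_in e p.2).

(** Syllables in G_v translate no coset, so this is the translation that a block word applies to the
    normal form of what follows. *)
Definition block_pos b : Gam := \prod_(p <- b) p.1.

Fixpoint block_nf b : seq syllable :=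
  if b is p :: b' then (lcos v p.1, p.2) :: strans p.1 (block_nf b') else [::].

(** Consecutive cosets of a block word differ exactly when the next first component lies outside the
    link subgroup. *)
Definition block_ok (p : block) : Prop :=
  [/\ gpsub [set~ v] p.1, ~ gpsub (link e v) p.1 & p.2 != 1].

Definition blocks_ok b := forall p, p \in b -> block_ok p.

Lemma blocks_ok_cons p b : blocks_ok (p :: b) <-> block_ok p /\ blocks_ok b.
Proof.
split=> [H|[Hp Hb] q]; last by rewrite inE => /orP[/eqP ->|/Hb].
by split=> [|q qb]; apply: H; rewrite inE ?eqxx ?qb ?orbT.
Qed.

Lemma block_prod_cons p b : block_prod (p :: b) = p.1 * gp_in e p.2 * block_prod b.
Proof. exact: big_cons. Qed.

Lemma block_prod_cat b c : block_prod (b ++ c) = block_prod b * block_prod c.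
Proof. exact: big_cat. Qed.

Lemma block_nf_cat b c :
  block_nf (b ++ c) = block_nf b ++ strans (block_pos b) (block_nf c).
Proof.
elim: b => [|p b IHb] /=; first by rewrite /block_pos big_nil strans1.
by rewrite IHb /block_pos big_cons stransM /strans map_cat.
Qed.

Lemma size_block_nf b : size (block_nf b) = size b.
Proof. by elim: b => //= p b <-; rewrite size_strans. Qed.

Lemma block_nf_reduced b : blocks_ok b -> vreduced (block_nf b).
Proof.
elim: b => [|p b IHb] // /blocks_ok_cons[[_ _ s1] bok] /=.
have /andP[so ao] := strans_reduced p.1 (IHb bok).
apply/andP; split; last by rewrite /= s1.
case: b so bok {IHb ao} => //= q b so /blocks_ok_cons[[_ qM _] _].
rewrite so andbT ltrans_lcos; apply/eqP => /lcosP; rewrite mulgA mulVg mul1g.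
exact: qM.
Qed.

Lemma gact_block b : blocks_ok b -> act (block_prod b) [::] = block_nf b.
Proof.
elim: b => [|p b IHb] bok; first by rewrite /block_prod big_nil gact1.
have [[pv pM s1] bok'] := (blocks_ok_cons _ _).1 bok.
have rb := block_nf_reduced bok'.
rewrite block_prod_cons !gactM // ?IHb // gact_in //.
have insE : insert p.2 (block_nf b) = (lcos v 1, p.2) :: block_nf b.
  case: b bok' {IHb rb bok} => [|q b] /=; first by rewrite insert_nil.
  move=> /blocks_ok_cons[[_ qM _] _]; rewrite insert_cons //.
  by apply/eqP => /lcos1P.
rewrite gact_strans //; last exact: insert_reduced.
by rewrite insE /= ltrans_lcos mulg1.
Qed.

Definition block_pow n b := flatten (nseq n b).

Lemma block_powS n b : block_pow n.+1 b = b ++ block_pow n b.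
Proof. by []. Qed.

Lemma blocks_ok_pow n b : blocks_ok b -> blocks_ok (block_pow n b).
Proof.
move=> bok; elim: n => [|n IHn] // p.
by rewrite block_powS mem_cat => /orP[/bok|/IHn].
Qed.

Lemma block_prod_pow n b : block_prod (block_pow n b) = block_prod b ^+ n.
Proof.
elim: n => [|n IHn]; first by rewrite /block_prod big_nil.
by rewrite block_powS block_prod_cat IHn expgS.
Qed.

Lemma size_block_pow n b : size (block_pow n b) = (n * size b)%N.
Proof. by elim: n => [|n IHn] //; rewrite block_powS size_cat IHn mulSn. Qed.

Definition sact z (p : syllable) : syllable := (ltrans z p.1, p.2).

Lemma sactM x y p : sact (x * y) p = sact x (sact y p).
Proof. by rewrite /sact /= ltransM. Qed.

Lemma sact1 p : sact 1 p = p.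
Proof. by case: p => q s; rewrite /sact ltrans1. Qed.

Lemma sactK x : cancel (sact x) (sact x^-1).
Proof. by move=> p; rewrite -sactM mulVg sact1. Qed.

Local Notation nths := (nth (set0, 1)).

Lemma nth_strans z om i : (i < size om)%N -> nths (strans z om) i = sact z (nths om i).
Proof. exact: nth_map. Qed.

Lemma nth_block_pow n b j : (j < n * size b)%N ->
  nths (block_nf (block_pow n b)) j =
  sact (block_pos b ^+ (j %/ size b)) (nths (block_nf b) (j %% size b)).
Proof.
elim: n j => [|n IHn] j //; rewrite mulSn => jn.
rewrite block_powS block_nf_cat nth_cat size_block_nf.
have [jb|bj] := ltnP; first by rewrite divn_small // modn_small // expg0 sact1.
have b0 : (0 < size b)%N by case: (b) jn bj => //=; rewrite muln0.
have jbn : (j - size b < n * size b)%N by rewrite ltn_subLR.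
rewrite nth_strans ?size_block_nf ?size_block_pow // IHn // -sactM -expgS.
have -> : j = (size b + (j - size b))%N by rewrite subnKC.
by rewrite addKn modnDl divnDl // divnn b0 add1n.
Qed.

Lemma mulg_intertwine (x y z : Gam) n : x * y = z * x -> x * y ^+ n = z ^+ n * x.
Proof.
move=> E; elim: n => [|n IHn]; first by rewrite mulg1 mul1g.
by rewrite expgSr mulgA IHn -mulgA E mulgA expgSr.
Qed.

Section Conjugate.
Variables (x : Gam) (b b' : seq block).
Hypotheses (bok : blocks_ok b) (b'ok : blocks_ok b').
Hypothesis conj : x * block_prod b = block_prod b' * x.

Let act_pow n : act (x * block_prod b ^+ n) [::] = act x (block_nf (block_pow n b)).
Proof.
have okn := blocks_ok_pow (n := n) bok.
by rewrite gactM // -block_prod_pow gact_block.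
Qed.

(** Applied to the empty sequence, x b^n has at least n |b| - B syllables by [gact_local], whereas
    b'^n x has at most n |b'| + c. *)
Lemma conj_size_le : (size b <= size b')%N.
Proof.
have [B HB] := gact_local x; set c := size (act x [::]).
rewrite leqNgt; apply/negP => kk.
(* One more than the total error B + c, while [size b' < size b] makes a difference of at least
   n. *)
pose n := (B + c).+1.
have [pre [k [_ kB E]]] := HB _ (block_nf_reduced (blocks_ok_pow (n := n) bok)).
have okn' := blocks_ok_pow (n := n) b'ok.
have rx : vreduced (act x [::]) by exact: gact_reduced.
have [] := gact_full (block_prod b' ^+ n) rx.
rewrite -gactM // -(mulg_intertwine n conj) act_pow E -(block_prod_pow n b') gact_block // size_cat.
rewrite size_strans size_drop !size_block_nf !size_block_pow -/c => le _.
have := leq_trans (leq_addl _ _) le; rewrite leq_subLR; apply/negP; rewrite -ltnNge.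
apply: (@leq_trans (n * (size b').+1)); last by rewrite leq_mul2l kk orbT.
by rewrite mulnS addnA ltn_add2r ltnS leq_add2r.
Qed.

End Conjugate.

(** A long power relation describes one normal form in two ways: once cancellation has stopped it
    begins with periods of b', and past a bounded prefix it is a translate of periods of b. A common
    window of length [size b] exhibits b' as a rotation of b; two periods of b contain every
    rotation. *)
Lemma conj_shift x b b' : blocks_ok b -> blocks_ok b' -> (0 < size b)%N ->
    x * block_prod b = block_prod b' * x ->
  size b' = size b /\ exists2 d, (d < size b)%N &
    exists z, forall i, (i < size b)%N ->
      nths (block_nf b') i = sact z (nths (block_nf (block_pow 2 b)) (d + i)).
Proof.
move=> bok b'ok b0 xb.
have sz : size b' = size b.
  apply/eqP; rewrite eqn_leq (conj_size_le bok b'ok xb) andbT.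
  apply: (@conj_size_le x^-1) => //.
  by apply: (mulgI x); rewrite !mulgA mulgV mul1g xb mulgK.
split=> //.
have [B HB] := gact_local x; pose k := size b.
(* The window compared below is period number ee.+1 of b', counted from 0, with ee <= B, so B.+2
   periods contain it. *)
have [n nE] : exists n, n = B.+2 by exists B.+2.
pose s N := act (x * block_prod b ^+ (N * n)) [::].
have rs N : vreduced (s N) by exact: gact_reduced.
have sE N : s N = act x (block_nf (block_pow (N * n) b)).
  have okn := blocks_ok_pow (n := (N * n)%N) bok.
  by rewrite /s gactM // -block_prod_pow gact_block.
have sS N : s N.+1 = act (block_prod b' ^+ n) (s N).
  by rewrite /s -gactM // mulSn expgnDr !mulgA (mulg_intertwine n xb).
have okn' := blocks_ok_pow (n := n) b'ok.
have actn : act (block_prod b' ^+ n) [::] = block_nf (block_pow n b').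
  by rewrite -block_prod_pow gact_block.
have s_ge N : (N * n * k <= size (s N) + B)%N.
  have [pre [j [_ jB E]]] := HB _ (block_nf_reduced (blocks_ok_pow (n := (N * n)%N) bok)).
  rewrite sE E size_cat size_strans size_drop size_block_nf size_block_pow.
  by rewrite -/k; move: (N * n * k)%N jB => K jB; lia.
(* size (s N) - N * n * k is nonincreasing and bounded below, hence stationary at some N: there
   the block word b' ^ n is prepended without any cancellation. *)
have [N /eqP szN] : exists N, size (s N.+1) == (size (s N) + n * k)%N.
  apply: contrapT => /forallNP ne.
  have lt N : (size (s N.+1) < size (s N) + n * k)%N.
    rewrite ltn_neqAle; apply/andP; split; first exact/negP/ne.
    rewrite sS; have [+ _] := gact_full (block_prod b' ^+ n) (rs N).
    by rewrite actn size_block_nf size_block_pow sz.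
  have le N : (size (s N) + N <= size (s 0) + N * n * k)%N.
    elim: N => [|N IHN]; first by rewrite !mul0n.
    by move: (lt N) IHN; rewrite mulSn mulnDl; lia.
  (* The deficit would grow by one at each step, but [s_ge] bounds it by [size (s 0) + B]. *)
  have := leq_add (le (size (s 0) + B).+1) (s_ge (size (s 0) + B).+1).
  set K := (_ * n * k)%N; set S0 := size (s _).
  by move=> H; have : false by lia.
have [_ /(_ _)] := gact_full (block_prod b' ^+ n) (rs N).
rewrite -sS actn size_block_nf size_block_pow sz -/k => /(_ szN) sN1.
have [pre [beta [eB betaB E]]] := HB _ (block_nf_reduced (blocks_ok_pow (n := (N.+1 * n)%N) bok)).
move: sN1; rewrite sE E => sN1 {szN}.
set m := (N.+1 * n)%N in E sN1; set ee := size pre in eB.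
(* The position in the normal form of b^m that lands at position ee.+1 * k: past [pre], and at the
   start of a period of b'. *)
pose m0 := (beta + (ee.+1 * k - ee))%N.
exists (m0 %% k)%N; first by rewrite ltn_mod.
(* The translations of the period of b containing m0 and of x are applied, and that of period ee.+1
   of b' is undone. *)
exists ((block_pos b' ^+ ee.+1)^-1 * (vproj x * block_pos b ^+ (m0 %/ k))) => i ik.
have ee_le : (ee <= ee.+1 * k)%N by apply: leq_trans (leq_pmulr _ b0).
have jn : (ee.+1 * k + i < n * k)%N.
  apply: (@leq_trans (ee.+2 * k)); first by rewrite [(ee.+2 * k)%N]mulSn addnC ltn_add2r.
  by rewrite leq_mul2r nE !ltnS eB orbT.
have := congr1 (fun l => nths l (ee.+1 * k + i)) sN1.
rewrite /= !nth_cat size_block_nf size_block_pow sz -/k jn.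
rewrite [in X in X = _]ltnNge -/ee (leq_trans ee_le (leq_addr _ _)) /=.
have idx : (beta + (ee.+1 * k + i - ee))%N = (m0 + i)%N.
  by rewrite /m0 -addnA; congr (_ + _)%N; rewrite -addnBAC.
have size_eq : (size (block_nf (block_pow m b)) - beta + ee >= n * k)%N.
  have := congr1 size sN1; rewrite !size_cat !size_strans size_drop => szE.
  by rewrite addnC szE size_block_nf size_block_pow sz leq_addr.
have bm : (m0 + i < m * k)%N.
  rewrite -idx; move: size_eq; rewrite size_block_nf size_block_pow -/k => szm.
  by lia.
rewrite nth_strans; last by rewrite size_drop size_block_nf size_block_pow -/k; lia.
have d2 : (m0 %% k + i < 2 * k)%N by rewrite mul2n -addnn -addSn leq_add ?ltn_mod // ltnW.
rewrite nth_drop idx !nth_block_pow ?sz //= -/k.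
rewrite divnMDl // modnMDl (divn_small ik) (modn_small ik) addn0 => H.
rewrite -(sactK (block_pos b' ^+ ee.+1) (nths (block_nf b') i)) -H -!sactM -!mulgA -expgnDr.
by rewrite modnDml -divnMDl // addnA -divn_eq.
Qed.

End BlockWords.

(** * Markers *)

Section Markers.
Variables (V : finType) (e : rel V) (G : V -> groupType).
Hypotheses (e_sym : symmetric e) (e_irr : irreflexive e).
Hypothesis G_nontrivial : forall v, exists g : G v, g <> 1%g.
Variable X : forall v, genset (G v).
Local Notation Gam := (graph_product e G).
Local Notation len := (word_length (gp_genset e X)).
Variables (v : V) (U : {set V}).
Hypothesis vU : v \notin U.
Local Notation block := (Gam * G v)%type.
Local Notation L := (U :&: link e v).
Implicit Types (x y z t u : Gam) (b c : seq block) (A : {set V}).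

Lemma ltrans_fix u y : ltrans u (lcos v y) = lcos v y <-> gpsub (link e v) (y^-1 * u * y).
Proof.
by rewrite ltrans_lcos; split=> [/esym/lcosP|H]; [|apply/esym/lcosP]; rewrite mulgA.
Qed.

(* Adding a translate by g thus cuts a pointwise stabiliser contained in G_A down to the
   neighbours of w. *)
Lemma gpsub_conj A w (g : G w) u : w \notin A -> g != 1 ->
  gpsub A u -> gpsub A ((gp_in e g)^-1 * u * gp_in e g) -> gpsub (link e w) u.
Proof.
move=> wA g1 Au; rewrite /gpsub /= !retrM retrV.
(* The retraction to A kills g but fixes u and its conjugate, so g commutes with u. *)
have -> : retr A (gp_in e g) = 1 by rewrite -gpw_letter retr_gpw /= (negPf wA) gpw_nil.
rewrite Au invg1 mul1g mulg1 => uE.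
have comm : u * gp_in e g = gp_in e g * u by rewrite {2}uE !mulgA mulgV mul1g.
have uw : gpsub [set~ w] u.
  by apply: gpsubS Au; apply/fintype.subsetP => a aA; rewrite !inE; apply: contraNneq wA => <-.
(* Relative to w, the first coset in the normal form is that of u for u g, and the trivial one for g
   u. *)
have : gact (v := w) (u * gp_in e g) [::] = gact (gp_in e g * u) [::] by rewrite comm.
rewrite !gactM // !gact_in ?gact_reduced // !gact_strans //= ?insert_nil //.
  by case; rewrite ltrans_lcos mulg1 => /lcos1P.
by rewrite /vreduced /= g1.
Qed.

(** The stabiliser of the trivial coset in G_U is G_L. While some w in U \ A is not adjacent to all
    of A, translates by an element of G_w shrink A. At the end G_A commutes with the vertex groups
    in U \ A, so it is normalised by G_U and, as A lies in the link of v, fixes every coset. *)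
Lemma stabiliser_family : exists2 ps : seq Gam, (forall p, p \in ps -> gpsub U p) &
  forall u, gpsub U u -> (forall p, p \in ps -> ltrans u (lcos v p) = lcos v p) ->
  forall y, gpsub U y -> ltrans u (lcos v y) = lcos v y.
Proof.
suff main n A (ps : seq Gam) : (#|A| < n)%N -> A \subset L -> (forall p, p \in ps -> gpsub U p) ->
    (forall u, gpsub U u -> (forall p, p \in ps -> ltrans u (lcos v p) = lcos v p) ->
       gpsub A u) ->
    exists2 ps : seq Gam, (forall p, p \in ps -> gpsub U p) &
    forall u, gpsub U u -> (forall p, p \in ps -> ltrans u (lcos v p) = lcos v p) ->
    forall y, gpsub U y -> ltrans u (lcos v y) = lcos v y.
  apply: (main _ L [:: 1]) => //.
    by move=> p; rewrite inE => /eqP ->; exact: gpsub1.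
  move=> u Uu /(_ 1); rewrite inE eqxx => /(_ isT)/ltrans_fix.
  by rewrite invg1 mul1g mulg1; exact: gpsubI.
elim: n A ps => // n IHn A ps; rewrite ltnS => An AL psU psA.
have [[w [a [wU wA aA]]] naw|full] := pselect (exists w a,
    [/\ w \in U, w \notin A, a \in A & ~~ e w a]).
  have [g /eqP g1] := G_nontrivial w.
  have gU : gpsub U (gp_in e g) by rewrite -gpw_letter; apply: gpw_sub; rewrite /= wU.
  apply: (IHn (A :&: link e w) (ps ++ [seq gp_in e g * p | p <- ps])).
  - apply: leq_trans An; apply: proper_card.
    apply/fintype.properP; split; first exact: finset.subsetIl.
    by exists a => //; rewrite !inE aA.
  - exact: fintype.subset_trans (finset.subsetIl _ _) AL.
  - move=> p; rewrite mem_cat => /orP[/psU //|/mapP[q /psU Uq ->]].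
    exact: gpsubM.
  move=> u Uu fixu.
  have Au : gpsub A u by apply: psA => // p pps; apply: fixu; rewrite mem_cat pps.
  apply: gpsubI => //; apply: (gpsub_conj wA g1 Au); apply: psA.
    by apply: gpsubM => //; apply: gpsubM => //; exact: gpsubV.
  move=> p pps; apply/ltrans_fix.
  have /ltrans_fix : ltrans u (lcos v (gp_in e g * p)) = lcos v (gp_in e g * p).
    by apply: fixu; rewrite mem_cat map_f ?orbT.
  by rewrite invgM !mulgA.
exists ps => // u Uu fixu y /gpsubP[w wU <-]; apply/ltrans_fix.
apply: (@gpsubS _ _ _ A); first exact: fintype.subset_trans AL (finset.subsetIr _ _).
have {Uu fixu} : gpsub A u by exact: psA.
elim: w wU u => [|l w IHw] /= wU u Au; first by rewrite gpw_nil invg1 mul1g mulg1.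
have /andP[lU {}wU] := wU.
rewrite gpw_cons invgM.
set g := gp_letter e l; set W := gpw e w.
have -> : W^-1 * g^-1 * u * (g * W) = W^-1 * (g^-1 * u * g) * W by rewrite !mulgA.
apply: IHw => //; have [lA|lA] := boolP (tag l \in A).
  by have Ag := gp_letter_sub e lA; apply: gpsubM => //; apply: gpsubM => //; exact: gpsubV.
suff ug : u * g = g * u by rewrite -mulgA ug mulgA mulVg mul1g.
apply: link_comm; apply: gpsubS Au; apply/fintype.subsetP => a aA; rewrite inE.
by apply: contrapT => /negP naw; apply: full; exists (tag l), a.
Qed.

Definition gate_block (p : block) : Prop :=
  [/\ gpsub U p.1, gate X L p.1, p.1 <> 1 & p.2 != 1].

Definition gate_blocks b := forall p, p \in b -> gate_block p.

Lemma gate_block_ok p : gate_block p -> block_ok p.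
Proof.
case=> Up gp p1 s1; split=> //; last first.
  by move=> Mp; apply: p1; apply: (gate_sub (L := L)) gp _; exact: gpsubI.
by apply: gpsubS Up; apply/fintype.subsetP => a aA; rewrite !inE; apply: contraNneq vU => <-.
Qed.

Lemma gate_blocks_ok b : gate_blocks b -> blocks_ok b.
Proof. by move=> H p /H; exact: gate_block_ok. Qed.

Lemma gate_blocks_cons p b : gate_blocks (p :: b) <-> gate_block p /\ gate_blocks b.
Proof.
split=> [H|[Hp Hb] q]; last by rewrite inE => /orP[/eqP ->|/Hb].
by split=> [|q qb]; apply: H; rewrite inE ?eqxx ?qb ?orbT.
Qed.

Lemma gate_blocks_cat b c : gate_blocks b -> gate_blocks c -> gate_blocks (b ++ c).
Proof. by move=> Hb Hc p; rewrite mem_cat => /orP[/Hb|/Hc]. Qed.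

(** A coset determines its shortest representative, so blocks can be read off one at a time. *)
Lemma block_nf_inj b b' : gate_blocks b -> gate_blocks b' ->
  block_nf b = block_nf b' -> b = b'.
Proof.
elim: b b' => [|[t s] b IHb] [|[t' s'] b'] //.
move=> /gate_blocks_cons[[Ut gt _ _] okb] /gate_blocks_cons[[Ut' gt' _ _] okb'] /=.
case=> /lcosP tt' -> E.
have tE : t = t' by apply: gate_inj gt gt' _; apply: gpsubI tt'; exact: gpsubM (gpsubV Ut) Ut'.
rewrite tE in E *; congr (_ :: _); apply: IHb => //.
by rewrite -(strans1 (block_nf b)) -(mulVg t') stransM E -stransM mulVg strans1.
Qed.

Variable p0 : block.
Hypothesis p0ok : gate_block p0.

(** A single block suffices if its first component is the gate of x^-1 p. When x^-1 p is in the link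
    subgroup that gate is 1, which blocks exclude, so [p0] first moves to another coset. *)
Lemma reach_coset x p : gpsub U x -> gpsub U p -> exists c,
  [/\ gate_blocks c, gpsub U (block_pos c) & lcos v p \in map fst (strans x (block_nf c))].
Proof.
move=> Ux Up; have [U0 g0 p1 s1] := p0ok.
suff step y : gpsub U y -> ~ gpsub (link e v) (y^-1 * p) ->
    exists t, [/\ gate_block (t, p0.2) & lcos v p = lcos v (y * t)].
  have [xp|xp] := pselect (gpsub (link e v) (x^-1 * p)).
    have [||t [tok tE]] := step (x * p0.1).
    - exact: gpsubM.
    - rewrite invgM -mulgA => Mx; have [_ + _] := gate_block_ok p0ok; apply.
      by have := gpsubM xp (gpsubV Mx); rewrite invgM invgK mulVKg.
    have [Ut _ _ _] := tok.
    exists [:: p0; (t, p0.2)]; split.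
    - by do 2 (apply/gate_blocks_cons; split=> //).
    - by rewrite /block_pos big_cons big_seq1; exact: gpsubM.
    - by rewrite /= !ltrans_lcos tE !inE mulgA eqxx orbT.
  have [//|//|t [tok tE]] := step x; have [Ut _ _ _] := tok.
  exists [:: (t, p0.2)]; split.
  - by apply/gate_blocks_cons; split.
  - by rewrite /block_pos big_seq1.
  - by rewrite /= ltrans_lcos tE inE.
move=> Uy nM; have Uyp : gpsub U (y^-1 * p) by apply: gpsubM => //; exact: gpsubV.
have [t [h [yE Ut Lh _ gt]]] := gateP e_sym e_irr X L Uyp.
have Mh : gpsub (link e v) h.
  by apply: gpsubS Lh; apply/fintype.subsetP => a; rewrite !inE => /and3P[].
exists t; split.
  by split=> //= t1; apply: nM; rewrite yE t1 mul1g.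
apply/esym/lcosP; rewrite invgM -mulgA yE mulgA mulVg mul1g.
exact: Mh.
Qed.

Lemma reach_cosets x (ps : seq Gam) : gpsub U x -> (forall p, p \in ps -> gpsub U p) ->
  exists2 c, gate_blocks c &
    forall p, p \in ps -> lcos v p \in map fst (strans x (block_nf c)).
Proof.
elim: ps x => [|p ps IHps] x Ux Ups; first by exists [::].
have [|c [cok Uc pc]] := @reach_coset x p Ux; first by apply: Ups; rewrite mem_head.
have [||c' c'ok c'ps] := IHps (x * block_pos c).
- exact: gpsubM.
- by move=> q qps; apply: Ups; rewrite inE qps orbT.
exists (c ++ c'); first exact: gate_blocks_cat.
move=> q; rewrite inE block_nf_cat /strans map_cat map_cat mem_cat -/(strans _ _).
case/orP=> [/eqP ->|/c'ps]; first by rewrite pc.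
by rewrite stransM => ->; rewrite orbT.
Qed.

Definition marker c := gate_blocks c /\ forall u, gpsub U u ->
  (forall q, q \in map fst (block_nf c) -> ltrans u q = q) ->
  forall y, gpsub U y -> ltrans u (lcos v y) = lcos v y.

Lemma marker_exists : exists c, marker c.
Proof.
have [ps psU psP] := stabiliser_family.
have [c cok cps] := reach_cosets (gpsub1 e G U) psU.
exists c; split=> // u Uu fixu; apply: psP => // p pps; apply: fixu.
by have := cps p pps; rewrite strans1.
Qed.

Lemma block_nf_coset b q : gate_blocks b -> q \in map fst (block_nf b) ->
  exists2 y, gpsub U y & q = lcos v y.
Proof.
move=> bok; suff main x : gpsub U x -> q \in map fst (strans x (block_nf b)) ->
    exists2 y, gpsub U y & q = lcos v y.
  by move=> qb; apply: (main 1); rewrite ?strans1 //; exact: gpsub1.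
elim: b x bok => [|p b IHb] //= x /gate_blocks_cons[[Up _ _ _] bok] Ux.
rewrite -stransM inE ltrans_lcos => /orP[/eqP ->|]; first by exists (x * p.1) => //; exact: gpsubM.
by apply: IHb => //; exact: gpsubM.
Qed.

(** All cosets involved have representatives in G_U, so z may be replaced by its retraction u. As u
    fixes the cosets of c, it fixes all of them by the marker property, and the two normal forms
    coincide. *)
Lemma marker_rigid c b b' z : marker c -> gate_blocks b -> gate_blocks b' ->
  strans z (block_nf (c ++ b)) = block_nf (c ++ b') -> b = b'.
Proof.
move=> [cok cP] bok b'ok E.
have okb := gate_blocks_cat cok bok; have okb' := gate_blocks_cat cok b'ok.
pose u := retr U z.
have utr y y' : gpsub U y -> gpsub U y' -> ltrans z (lcos v y) = lcos v y' ->
    ltrans u (lcos v y) = lcos v y'.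
  rewrite !ltrans_lcos => Uy Uy' /lcosP/(gpsub_retrI U); rewrite finset.setIC.
  rewrite retrM retrV retrM Uy Uy' => H; apply/lcosP.
  by apply: gpsubS H; exact: finset.subsetIr.
have E' : strans u (block_nf (c ++ b)) = block_nf (c ++ b').
  rewrite -E; apply/seq.eq_in_map => -[q s] qb; congr (_, _) => /=.
  have [|y Uy qE] := @block_nf_coset (c ++ b) q okb; first exact: (map_f fst qb).
  have zq : ltrans z (lcos v y) \in map fst (block_nf (c ++ b')).
    by rewrite -qE -E -map_comp; apply/mapP; exists (q, s).
  by have [y' Uy' zE] := block_nf_coset okb' zq; rewrite qE zE; exact: utr.
have cE : strans u (block_nf c) = block_nf c.
  have := congr1 (take (size c)) E'; rewrite !block_nf_cat /strans map_cat.
  by rewrite !take_size_cat ?size_map ?size_block_nf.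
have triv : strans u (block_nf (c ++ b)) = block_nf (c ++ b).
  apply: map_id_in => -[q s] qb; congr (_, _) => /=.
  have [|y Uy ->] := @block_nf_coset (c ++ b) q okb; first exact: (map_f fst qb).
  apply: cP => //; first exact: gpsub_retr.
  move=> q' /mapP[p pc ->].
  have : [seq (ltrans u p.1, p.2) | p <- block_nf c] = [seq id p | p <- block_nf c].
    by rewrite map_id.
  by move/seq.eq_in_map => /(_ p pc)/(congr1 fst).
have /eqP := block_nf_inj okb okb' (etrans (esym triv) E').
by rewrite eqseq_cat // eqxx => /eqP.
Qed.

(* For each rotation there is at most one word starting with the marker. *)
Lemma conj_class_blocks c k (g : Gam) (s : seq (seq block)) : marker c -> (0 < k)%N -> uniq s ->
  (forall b, b \in s -> [/\ gate_blocks b, size b = k &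
     conj_class (block_prod (c ++ b)) = conj_class g]) ->
  (size s <= size c + k)%N.
Proof.
move=> mc k0; case: s => // b0 s us sP.
have [b0ok szb0 cb0] := sP b0 (mem_head _ _).
have ok0 := gate_blocks_ok (gate_blocks_cat mc.1 b0ok).
pose K := (size c + k)%N.
have szK b : size b = k -> size (c ++ b) = K by rewrite size_cat => ->.
have rot b : b \in b0 :: s -> exists d : 'I_K, exists z, 
    block_nf (c ++ b) = take K (drop d (strans z (block_nf (block_pow 2 (c ++ b0))))).
  move=> bs; have [bok szb cb] := sP b bs.
  have okb := gate_blocks_ok (gate_blocks_cat mc.1 bok).
  have : conj_class (block_prod (c ++ b0)) (block_prod (c ++ b)).
    by rewrite cb0 -cb; exists 1; rewrite ?conjg1.
  case=> h _ /esym hE.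
  have xb : h^-1 * block_prod (c ++ b0) = block_prod (c ++ b) * h^-1.
    by rewrite hE conjgE !mulgA mulgK.
  have [|sz [d dK [z zP]]] := conj_shift e_sym e_irr ok0 okb _ xb.
    by rewrite szK // addn_gt0 k0 orbT.
  rewrite szK // in dK zP.
  have sz2 : size (block_nf (block_pow 2 (c ++ b0))) = (K + K)%N.
    by rewrite size_block_nf size_block_pow szK // mul2n addnn.
  have szd : size (drop d (strans z (block_nf (block_pow 2 (c ++ b0))))) = (K + K - d)%N.
    by rewrite size_drop size_strans sz2.
  exists (Ordinal dK), z; apply: (@eq_from_nth _ (set0, 1)).
    by rewrite size_block_nf szK // size_take szd; case: ltnP => //; lia.
  move=> i; rewrite size_block_nf szK // => iK.
  rewrite zP // nth_take // nth_drop nth_strans // sz2.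
  by move: dK iK => /=; lia.
(* [choice] needs a total function; the type ['I_K.+1] offers [ord0] as a value off the list. *)
have rot' (b : seq block) : exists d : 'I_K.+1, b \in b0 :: s -> (d < K)%N /\ exists z,
    block_nf (c ++ b) = take K (drop d (strans z (block_nf (block_pow 2 (c ++ b0))))).
  have [/rot[d [z E]]|nbs] := boolP (b \in b0 :: s); last by exists ord0.
  by exists (widen_ord (leqnSn K) d) => _; split=> //=; exists z.
have [d dP] := choice rot'.
have dinj : {in b0 :: s &, injective d}.
  move=> b b' bs b's dbb'; have [bok _ _] := sP b bs; have [b'ok _ _] := sP b' b's.
  have [_ [z E]] := dP b bs; have [_ [z' E']] := dP b' b's.
  (* Equal offsets make both normal forms translates of the same window of the doubled word. *)
  apply: (@marker_rigid c b b' (z' * z^-1) mc bok b'ok).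
  rewrite E E' dbb' /strans map_take map_drop -!/(strans _ _) -stransM.
  by rewrite mulgVK.
have : (size [seq nat_of_ord (d b) | b <- b0 :: s] <= size (iota 0 K))%N; last first.
  by rewrite size_map size_iota.
apply: uniq_leq_size => [|i /mapP[b bs ->]]; last by rewrite mem_iota /=; have [] := dP b bs.
rewrite map_inj_in_uniq // => b b' bs b's /val_inj; exact: dinj.
Qed.

Lemma conj_class_size b b' : gate_blocks b -> gate_blocks b' ->
  conj_class (block_prod b) = conj_class (block_prod b') -> size b = size b'.
Proof.
move=> /gate_blocks_ok bok /gate_blocks_ok b'ok E.
suff le (a a' : seq block) : blocks_ok a -> blocks_ok a' ->
    conj_class (block_prod a) = conj_class (block_prod a') -> (size a <= size a')%N.
  by apply/eqP; rewrite eqn_leq !le.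
move=> {b b' bok b'ok E} aok a'ok E.
have [h _ /esym hE] : conj_class (block_prod a) (block_prod a').
  by rewrite E; exists 1; rewrite ?conjg1.
apply: (@conj_size_le _ _ _ e_sym e_irr _ h^-1) => //.
by rewrite hE conjgE !mulgA mulgK.
Qed.

End Markers.

(** * Decomposition of elements into block words with control of length *)

Section Decomposition.
Variables (V : finType) (e : rel V) (G : V -> groupType).
Hypotheses (e_sym : symmetric e) (e_irr : irreflexive e).
Variable X : forall v, genset (G v).
Local Notation Gam := (graph_product e G).
Local Notation len := (word_length (gp_genset e X)).
Variables (v : V) (U : {set V}).
Hypothesis vU : v \notin U.
Local Notation block := (Gam * G v)%type.
Local Notation L := (U :&: link e v).
Implicit Types (x y z t u : Gam) (b c : seq block) (A : {set V}).

Definition block_weight (p : block) : nat := len p.1 + word_length (X v) p.2.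

Definition blocks_weight b : nat := \sum_(p <- b) block_weight p.

Lemma len_block_prod b : (len (block_prod b) <= blocks_weight b)%N.
Proof.
rewrite /blocks_weight; elim: b => [|p b IHb]; first by rewrite /block_prod !big_nil word_length1.
rewrite block_prod_cons big_cons; apply: leq_trans (word_lengthM _ _ _) _.
by rewrite leq_add // /block_weight -(len_in e_irr) word_lengthM.
Qed.

Definition vsize x := size (gact (v := v) x [::]).

Lemma vsizeM x y : (vsize (x * y)%g <= vsize x + vsize y)%N.
Proof.
rewrite /vsize gactM // addnC.
have ry : vreduced (gact (v := v) y [::]) by exact: gact_reduced.
by have [] := gact_full e_sym e_irr x ry.
Qed.

Lemma vsize_gpw w : (vsize (gpw e w) <= vcount v w)%N.
Proof. by rewrite /vsize -vnf_gact //; exact: size_foldr_vact. Qed.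

Lemma vsize_reduced w : reduced e w -> vsize (gpw e w) = vcount v w.
Proof. by move=> rw; rewrite /vsize -vnf_gact //; exact/eqP/rw. Qed.

Lemma vsize_sub x : gpsub U x -> vsize x = 0%N.
Proof.
move=> Ux; rewrite /vsize gact_strans //; apply: gpsubS Ux.
by apply/fintype.subsetP => a aA; rewrite !inE; apply: contraNneq vU => <-.
Qed.

Lemma vsize_block b : gate_blocks X U b -> vsize (block_prod b) = size b.
Proof. by move=> /(gate_blocks_ok vU) bok; rewrite /vsize gact_block // size_block_nf. Qed.

(** A reduced word is cut at its first letter s at v. The part before it is t h with t a gate and h
    in G_L; h commutes with G_v and is passed on to the rest. The leading syllable s' of the
    decomposed rest merges with s: if t = 1 the product s s' leads, otherwise (t, s s') is a new
    block. *)
Lemma block_decomposition g : gpsub (v |: U) g -> exists s b y,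
  [/\ gate_blocks X U b, gpsub U y, g = gp_in e s * block_prod b * y,
      (size b + (s != 1%g) <= vsize g)%N &
      (word_length (X v) s + blocks_weight b + len y <= len g)%N].
Proof.
have [n] := ubnP (vsize g); elim: n g => // n IHn g; rewrite ltnS => gn vUg.
have [w [wE rw wl]] := reduced_word e_sym e_irr X g.
have wA : all [pred l | tag l \in v |: U] w.
  by apply: (reduced_sub e_sym e_irr) => //; rewrite wE.
have wU w' : {subset w' <= w} -> vcount v w' = 0%N -> gpsub U (gpw e w').
  move=> w'w /eqP; rewrite vcount_eq0 => /allP w'v; apply: gpw_sub; apply/allP => l lw'.
  by have := allP wA l (w'w _ lw'); have := w'v l lw'; rewrite /= !inE => /negPf ->.
have gv : vsize g = vcount v w by rewrite -wE vsize_reduced.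
have [c0|c0] := posnP (vcount v w).
  exists 1, [::], g; split=> //; first by rewrite -wE; exact: wU.
  - by rewrite /block_prod big_nil gp_in1 !mul1g.
  - by rewrite eqxx.
  - by rewrite /blocks_weight big_nil word_length1.
have [w1 [l [w2 [wE' lv w10]]]] := vcount_split c0.
have [rw1 rlw2] : reduced e w1 /\ reduced e (l :: w2) by apply: reduced_cat; rewrite -wE'.
have [_ rw2] := reduced_cat (w := [:: l]) rlw2.
have Uw1 : gpsub U (gpw e w1) by apply: wU => // l' l'w1; rewrite wE' mem_cat l'w1.
have [t [h [tE Ut Lh lent gt]]] := gateP e_sym e_irr X L Uw1.
have Mh : gpsub (link e v) h.
  by apply: gpsubS Lh; apply/fintype.subsetP => a; rewrite !inE => /and3P[].
have Uh : gpsub U h.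
  by apply: gpsubS Lh; apply/fintype.subsetP => a; rewrite !inE => /and3P[].
pose s := vpart v l; pose g' := h * gpw e w2.
have gE : g = t * gp_in e s * g'.
  rewrite -wE wE' gpw_cat gpw_cons (gp_letter_vpart e lv) tE /g'.
  by rewrite -!mulgA; congr (_ * _); rewrite !mulgA (link_comm _ Mh).
have vg : vsize g = (vcount v w2).+1.
  by rewrite gv wE' vcount_cat w10 /vcount /= lv eqxx.
have vg' : (vsize g' <= vcount v w2)%N.
  apply: leq_trans (vsizeM _ _) _; rewrite vsize_sub // add0n; exact: vsize_gpw.
have leng : (len t + word_length (X v) s + len g' <= len g)%N.
  have -> : len g = (len (gpw e w1) + (word_length (X v) s + len (gpw e w2)))%N.
    by rewrite -wl wE' !len_reduced // /word_weight big_cat big_cons (letter_lengthE X lv).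
  rewrite lent; have := word_lengthM (gp_genset e X) h (gpw e w2); rewrite -/g'; lia.
have vUg' : gpsub (v |: U) g'.
  apply: gpsubM; first by apply: gpsubS Uh; exact: finset.subsetUr.
  by apply: gpw_sub; move: wA; rewrite wE' all_cat /= => /and3P[].
have [|s' [b [y [bok Uy g'E szb wtb]]]] := IHn g' _ vUg'.
  by apply: leq_trans gn; rewrite vg ltnS.
have szb' : (size b < vsize g)%N by move: vg'; rewrite vg; lia.
have ss' := word_lengthM (X v) s s'.
have gE' : g = t * gp_in e (s * s') * block_prod b * y by rewrite gE g'E gp_inM !mulgA.
have [t1|t1] := pselect (t = 1).
  exists (s * s'), b, y; split=> //.
  - by rewrite gE' t1 mul1g.
  - by move: szb'; case: (_ != _); lia.
  - lia.
(* If the two cancelled, g would have at most [size b] syllables, fewer than [vsize g]. *)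
have ss1 : s * s' != 1.
  apply/eqP => ss1; have s1 : s != 1 by have [_] := vfull_cons lv (rlw2 v).
  have s'1 : s' != 1 by apply: contraNneq s1 => s'1; rewrite -ss1 s'1 mulg1.
  have : (vsize g <= size b)%N.
    rewrite gE' ss1 gp_in1 mulg1; apply: leq_trans (vsizeM _ _) _.
    apply: leq_trans (leq_add (vsizeM _ _) (leqnn _)) _.
    by rewrite (vsize_sub Ut) (vsize_sub Uy) vsize_block // addn0.
  by move: szb; rewrite s'1; lia.
exists 1, ((t, s * s') :: b), y; split=> //.
- by apply/gate_blocks_cons; split.
- by rewrite gp_in1 mul1g block_prod_cons gE'.
- by rewrite eqxx addn0.
- by rewrite word_length1 add0n /blocks_weight big_cons /block_weight /= -/(blocks_weight b); lia.
Qed.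

End Decomposition.

(** * Generating functions *)

Import Order.TTheory GRing.Theory Num.Theory.
Import numFieldNormedType.Exports.

Section WeightedSums.
Local Open Scope ring_scope.
Variable R : realType.

Definition wsum (T : choiceType) (D : set T) (f : T -> R) : \bar R :=
  \esum_(x in D) (f x)%:E.

Lemma wsum_ge0 (T : choiceType) (D : set T) (f : T -> R) :
  (forall x, 0 <= f x) -> (0 <= wsum D f)%E.
Proof. by move=> f0; apply: esum_ge0 => x _; rewrite lee_fin. Qed.

Lemma wsum_seq (T : choiceType) (D : set T) (f : T -> R) (s : seq T) :
  uniq s -> (forall x, x \in s -> D x) -> ((\sum_(x <- s) f x)%:E <= wsum D f)%E.
Proof.
move=> us sD; rewrite -sumEFin fsbig_seq //; apply: ereal_sup_ubound.
by exists [set` s] => //; split.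
Qed.

Lemma wsum_le (T : choiceType) (D : set T) (f : T -> R) (M : \bar R) :
  (forall s, uniq s -> (forall x, x \in s -> D x) -> ((\sum_(x <- s) f x)%:E <= M)%E) ->
  (wsum D f <= M)%E.
Proof.
move=> H; apply: ge_ereal_sup => _ [F [finF FD] <-].
rewrite fsbig_finite //= sumEFin; apply: H; first exact: fset_uniq.
by move=> x; rewrite in_fset_set // inE => /FD.
Qed.

Lemma wsum_gt (T : choiceType) (D : set T) (f : T -> R) (x : R) : (x%:E < wsum D f)%E ->
  exists s, [/\ uniq s, forall y, y \in s -> D y & x < \sum_(y <- s) f y].
Proof.
move=> xD; apply: contrapT => H; move: xD; apply/negP; rewrite -leNgt.
apply: wsum_le => s us sD; rewrite lee_fin leNgt; apply/negP => xs.
by apply: H; exists s.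
Qed.

Lemma wsum_fin (T : choiceType) (D : set T) (f : T -> R) : (forall x, 0 <= f x) ->
  (wsum D f < +oo)%E -> exists2 a : R, 0 <= a & wsum D f = a%:E.
Proof.
move=> f0; have := wsum_ge0 D f0.
by case: (wsum D f) => [a| |] //; rewrite lee_fin => a0 _; exists a.
Qed.

Lemma wsumZ (T : choiceType) (D : set T) (f : T -> R) (c : R) : 0 <= c ->
  wsum D (fun x => c * f x) = (c%:E * wsum D f)%E.
Proof.
move=> c0; rewrite /wsum /esum -ereal_supZl //; last first.
  apply/set0P; exists 0%E; exists set0; first exact: fsets_set0.
  by rewrite fsbig_set0.
congr ereal_sup; rewrite [RHS]image_comp; apply: eq_imagel => F [finF _] /=.
rewrite !fsbig_finite //= !sumEFin -EFinM; congr EFin.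
by rewrite mulr_sumr.
Qed.

Lemma wsum_prod (T T' : choiceType) (A : set T) (B : set T') (f : T -> R) (g : T' -> R) (a b : R) :
  (forall x, 0 <= f x) -> (forall y, 0 <= g y) -> 0 <= b ->
  wsum A f = a%:E -> wsum B g = b%:E ->
  wsum (A `*` B) (fun p => f p.1 * g p.2) = (a * b)%:E.
Proof.
move=> f0 g0 b0 Af Bg.
have E := @esum_esum R T T' A (fun=> B) (fun x y => (f x * g y)%:E) _.
apply: etrans (esym (E _)) _ => {E}; first by move=> x y _ _; rewrite lee_fin mulr_ge0.
rewrite (eq_esum (b := fun x => (b * f x)%:E)); last first.
  by move=> x _; rewrite -[LHS]/(wsum B (fun y => f x * g y)) wsumZ // Bg -EFinM mulrC.
by rewrite -[LHS]/(wsum A (fun x => b * f x)) wsumZ // Af -EFinM mulrC.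
Qed.

Lemma wsum_surj (T T' : choiceType) (D : set T) (E : set T') (phi : T' -> T)
    (f : T -> R) (g : T' -> R) :
  (forall x, D x -> exists y, [/\ E y, phi y = x & f x <= g y]) ->
  (wsum D f <= wsum E g)%E.
Proof.
move=> H; apply: wsum_le => s us sD.
have [s' [s'E sE le]] : exists s', [/\ forall y, y \in s' -> E y, map phi s' = s &
    \sum_(x <- s) f x <= \sum_(y <- s') g y].
  elim: s sD {us} => [|x s IHs] sD; first by exists [::]; split=> //; rewrite !big_nil.
  have [|s' [s'E <- le]] := IHs; first by move=> z zs; apply: sD; rewrite inE zs orbT.
  have [y [Ey <- lexy]] := H x (sD x (mem_head _ _)).
  exists (y :: s'); split=> //; last by rewrite !big_cons lerD.
  by move=> z; rewrite inE => /orP[/eqP ->|/s'E].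
apply: (@le_trans _ _ (\sum_(y <- s') g y)%:E); first by rewrite lee_fin.
by apply: wsum_seq => //; apply: (@map_uniq _ _ phi); rewrite sE.
Qed.

Lemma wsum_subset (T : choiceType) (D E : set T) (f : T -> R) :
  D `<=` E -> (wsum D f <= wsum E f)%E.
Proof. by move=> DE; apply: (wsum_surj (phi := id)) => x /DE Ex; exists x. Qed.

Lemma seq_argmax (T : eqType) (f : T -> R) a (s : seq T) :
  exists2 b, b \in a :: s & forall x, x \in a :: s -> f x <= f b.
Proof.
elim: s a => [|y s IHs] a.
  by exists a => [|x]; rewrite ?mem_head // inE => /eqP ->.
have [b bs bmax] := IHs y; have [ab|ba] := lerP (f a) (f b).
  by exists b => [|x]; rewrite inE ?bs ?orbT // => /orP[/eqP ->|/bmax].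
exists a => [|x]; rewrite ?mem_head // inE => /orP[/eqP -> //|/bmax/le_trans]; apply.
exact: ltW.
Qed.

(** The element of largest weight in a fiber of [key] carries at least 1/n of the weight of that
    fiber. *)
Lemma fiber_representatives (T K : eqType) (key : T -> K) (f : T -> R) n (s : seq T) :
  (forall x, 0 <= f x) -> (forall k, count [pred x | key x == k] s <= n)%N ->
  exists s', [/\ {subset s' <= s}, uniq (map key s') &
    \sum_(x <- s) f x <= n%:R * \sum_(x <- s') f x].
Proof.
move=> f0; have [m] := ubnP (size s); elim: m s => // m IHm [|a s] sm cs.
  by exists [::]; split=> //; rewrite !big_nil mulr0.
have [b] := seq_argmax f a [seq x <- s | key x == key a].
have -> : a :: [seq x <- s | key x == key a] = [seq x <- a :: s | key x == key a].
  by rewrite /= eqxx.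
rewrite mem_filter => /andP[/eqP ba bs] bmax.
have [|k|s' [s's us' le]] := IHm [seq x <- s | key x != key a].
- by apply: (@leq_ltn_trans (size s)) => //; rewrite size_filter; exact: count_size.
- apply: leq_trans (cs k) => /=; apply: leq_trans (leq_addl _ _).
  by rewrite count_filter; apply: sub_count => x /= /andP[].
exists (b :: s'); split.
- move=> x; rewrite inE => /orP[/eqP -> //|/s's]; rewrite mem_filter inE => /andP[_ ->].
  by rewrite orbT.
- rewrite /= us' andbT; apply/mapP => -[x /s's]; rewrite mem_filter => /andP[xa _].
  by rewrite ba => /esym/eqP; exact/negP.
rewrite (bigID (fun x => key x == key a)) /= [\sum_(x <- b :: s') _]big_cons mulrDr lerD //.
  rewrite -big_filter; apply: (@le_trans _ _ (\sum_(x <- [seq x <- a :: s | key x == key a]) f b)).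
    by rewrite big_seq [leRHS]big_seq; apply: ler_sum.
  rewrite big_const_seq count_predT iter_addr_0 -[leLHS]mulr_natl ler_wpM2r // ler_nat size_filter.
  exact: cs.
by rewrite big_cons eqxx /= -big_filter.
Qed.

Lemma harmonic_unbounded (m : nat) (B : R) : exists n, B < \sum_(k < n) (m + k).+1%:R^-1.
Proof.
apply: contrapT => /forallNP H; apply: (@dvg_harmonic R).
apply: nondecreasing_is_cvgn.
  apply: nondecreasing_series => k _ _; exact: harmonic_ge0.
exists (\sum_(k < m) (k.+1%:R)^-1 + B) => _ [n _ <-].
apply: (@le_trans _ _ (series harmonic (m + n)%N)).
  by apply: nondecreasing_series; [move=> k _ _; exact: harmonic_ge0|exact: leq_addl].
rewrite /series /= big_mkord big_split_ord /= lerD2l leNgt.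
exact/negP/H.
Qed.

End WeightedSums.

(** * Convergence by induction on the vertex set *)

Section Growth.
Local Open Scope ring_scope.
Variables (V : finType) (e : rel V) (G : V -> groupType).
Hypotheses (e_sym : symmetric e) (e_irr : irreflexive e).
Hypothesis G_nontrivial : forall v, exists g : G v, g <> 1%g.
Variable X : forall v, genset (G v).
Local Notation Gam := (graph_product e G).
Local Notation len := (word_length (gp_genset e X)).
Variables (R : realType) (r : R).
Hypotheses (r0 : 0 < r) (r1 : r <= 1).
Local Notation gweight := (fun g : Gam => r ^+ len g).
Local Notation vweight v := (fun s : G v => r ^+ word_length (X v) s).
Implicit Types (x y z t u : Gam) (U A : {set V}).

Let rX0 n : 0 <= r ^+ n. Proof. by rewrite exprn_ge0 // ltW. Qed.

Let rX_le m n : (m <= n)%N -> r ^+ n <= r ^+ m.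
Proof. by move=> mn; rewrite ler_wiXn2l // ltW. Qed.

Section Step.
Variables (v : V) (U : {set V}).
Hypothesis vU : v \notin U.
Local Notation block := (Gam * G v)%type.
Local Notation L := (U :&: link e v).
Local Notation bprod := (@block_prod V e G v).
Implicit Types (b c : seq block).

Definition gate_reps : set Gam := [set t | [/\ gpsub U t, gate X L t & t <> 1%g]].

Definition nontriv : set (G v) := [set s | s != 1%g].

Definition block_words k : set (seq block) := [set b | gate_blocks X U b /\ size b = k].

Local Notation bweight := (fun b : seq block => r ^+ blocks_weight X b).

Lemma gate_blockE (p : block) : gate_block X U p <-> (gate_reps `*` nontriv) p.
Proof. by split=> [[]|[[]]]. Qed.

Lemma wsum_block_words (tau sigma : R) k : 0 <= tau -> 0 <= sigma ->
  wsum gate_reps gweight = tau%:E ->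
  wsum nontriv (vweight v) = sigma%:E ->
  wsum (block_words k) bweight = ((tau * sigma) ^+ k)%:E.
Proof.
move=> tau0 sigma0 tauE sigmaE; elim: k => [|k IHk].
  rewrite (_ : block_words 0 = [set [::]]).
    by rewrite /wsum esum_set1 ?lee_fin // /blocks_weight big_nil !expr0.
  by apply/seteqP; split=> [b [_ /size0nil]//|b ->].
have bij : set_bij ((gate_reps `*` nontriv) `*` block_words k) (block_words k.+1)
    (fun p => p.1 :: p.2).
  split=> [[p b] /= [/gate_blockE pok [bok sb]]|[p b] [p' b'] _ _ /= [-> ->]//|].
    by split=> /=; [apply/gate_blocks_cons|rewrite sb].
  move=> [|p b] [] //= /gate_blocks_cons[/gate_blockE pok bok] [sb].
  by exists (p, b).
rewrite /wsum (reindex_esum _ _ _ _ bij) exprS.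
have pE := wsum_prod (fun t => rX0 (len t)) (fun s => rX0 (word_length (X v) s)) sigma0 tauE sigmaE.
have q0 : 0 <= tau * sigma by rewrite mulr_ge0.
rewrite -(wsum_prod (f := fun p : block => r ^+ len p.1 * r ^+ word_length (X v) p.2)
  _ _ (exprn_ge0 k q0) pE IHk) //; last by move=> p; rewrite mulr_ge0.
by apply: eq_esum => -[p b] _ /=; rewrite /blocks_weight big_cons !exprD.
Qed.

Lemma wsum_all_block_words (q : R) : 0 <= q -> q < 1 ->
  (forall k, wsum (block_words k) bweight = (q ^+ k)%:E) ->
  (wsum (gate_blocks X U : set (seq block)) bweight < +oo)%E.
Proof.
move=> q0 q1 qE; apply: (@le_lt_trans _ _ ((1 - q)^-1)%:E); last exact: ltry.
apply: wsum_le => s us sok; rewrite lee_fin.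
pose N := (\max_(b <- s) size b).+1.
have -> : \sum_(b <- s) bweight b = \sum_(k < N) \sum_(b <- s | size b == k) bweight b.
  rewrite (exchange_big_dep predT) //=; apply: eq_big_seq => b bs.
  have bN : (size b < N)%N by rewrite ltnS; exact: leq_bigmax_seq.
  rewrite (big_pred1 (Ordinal bN)) // => k; rewrite -val_eqE /= eq_sym.
apply: (@le_trans _ _ (\sum_(k < N) q ^+ k)).
  apply: ler_sum => k _; rewrite -big_filter -lee_fin -qE; apply: wsum_seq.
    exact: filter_uniq.
  by move=> b; rewrite mem_filter => /andP[/eqP sb /sok].
rewrite -[leRHS]mul1r ler_pdivlMr ?subr_gt0 // -[1 - q]opprB mulrN mulrC -subrX1 opprB.
by rewrite lerBlDr lerDl exprn_ge0.
Qed.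

(** Block decompositions cover G_(U + v), and as r <= 1 and their total length is at most that of g,
    their weights dominate. *)
Lemma step_finite (q : R) : 0 <= q -> q < 1 ->
  (forall k, wsum (block_words k) bweight = (q ^+ k)%:E) ->
  (wsum [set: G v] (vweight v) < +oo)%E ->
  (wsum (gpsub U : set Gam) gweight < +oo)%E ->
  (wsum (gpsub (v |: U) : set Gam) gweight < +oo)%E.
Proof.
move=> q0 q1 qE Gfin Ufin.
have [a a0 aE] := wsum_fin (fun s => rX0 (word_length (X v) s)) Gfin.
have [b b0 bE] :=
  wsum_fin (fun s : seq block => rX0 (blocks_weight X s)) (wsum_all_block_words q0 q1 qE).
have [c c0 cE] := wsum_fin (fun y : Gam => rX0 (len y)) Ufin.
have abE := wsum_prod (fun s => rX0 _) (fun s => rX0 _) b0 aE bE.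
have abcE := wsum_prod (fun p => mulr_ge0 (rX0 _) (rX0 _)) (fun y => rX0 _) c0 abE cE.
apply: (@le_lt_trans _ _ (a * b * c)%:E); last exact: ltry.
rewrite -abcE.
apply: (wsum_surj (phi := fun p : (G v * seq block) * Gam =>
  (gp_in e p.1.1 * bprod p.1.2 * p.2)%g)) => g.
move=> /(block_decomposition e_sym e_irr X vU)[s [bl [y [blok Uy gE _ le]]]].
exists ((s, bl), y); split=> //=.
by rewrite -!exprD rX_le.
Qed.

Variable B : R.
Hypothesis conj_bound : forall s : seq Gam, uniq (map (@conj_class Gam) s) ->
  \sum_(g <- s) r ^+ len g <= B.

Lemma step_infinite (q : R) : 1 <= q ->
  (forall k, wsum (block_words k) bweight = (q ^+ k)%:E) -> False.
Proof.
move=> q1 qE.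
(* The full weight q^(k+1) is at least 1, so some finite part exceeds one half. *)
have sk k : exists s : seq (seq block), [/\ uniq s, forall b, b \in s -> block_words k.+1 b &
    2^-1 < \sum_(b <- s) bweight b].
  apply: (@wsum_gt R _ (block_words k.+1) bweight); rewrite qE lte_fin; apply: (@lt_le_trans _ _ 1).
    by rewrite invf_lt1 // ltr1n.
  exact: exprn_ege1.
have [p0 p0ok] : exists p0 : block, gate_block X U p0.
  have [[|b s] [_ sP]] := sk 0%N; first by rewrite big_nil ltNge invr_ge0 ler0n.
  move=> _; have [] := sP b (mem_head _ _).
  by case: b {sP} => // p b /gate_blocks_cons[pok _] _; exists p.
have [c mc] := marker_exists e_sym e_irr G_nontrivial vU p0ok.
pose m := size c; pose W : R := r ^+ blocks_weight X c.
have W0 : 0 < W by exact: exprn_gt0.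
pose key b := conj_class (bprod (c ++ b)).
(* Behind the marker, a class contains at most m + k.+1 of these words, so representatives keep at
   least one half divided by that number. *)
have sk' k : exists s : seq (seq block), [/\ forall b, b \in s -> block_words k.+1 b,
    uniq (map key s) & (2 * (m + k).+1%:R)^-1 <= \sum_(b <- s) bweight b].
  have [s [us sP s2]] := sk k.
  have [|C|s' [s's us' le]] := @fiber_representatives R _ _ key bweight (m + k.+1) s.
  - by move=> b; exact: rX0.
  - rewrite -size_filter; have [->//|[b0 b0s]] : [seq b <- s | key b == C] = [::] \/
        exists b0, b0 \in [seq b <- s | key b == C].
      by case: [seq _ <- _ | _] => [|b0 s0]; [left|right; exists b0; rewrite mem_head].
    move: b0s; rewrite mem_filter => /andP[/eqP <- _].
    apply: (conj_class_blocks e_sym e_irr vU mc (ltn0Sn k) (g := bprod (c ++ b0))).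
      exact: filter_uniq.
    move=> b; rewrite mem_filter => /andP[/eqP kb /sP[bok sb]]; split=> //.
  exists s'; split=> //; first by move=> b /s's/sP.
  rewrite invfM ler_pdivrMr ?ltr0n // mulrC -addnS.
  exact: le_trans (ltW s2) le.
have {sk sk'} [s sP] := choice sk'.
pose S N := flatten [seq s k | k <- iota 0 N].
have SP N b : b \in S N -> gate_blocks X U b /\ (size b <= N)%N.
  move=> /flatten_mapP[k]; rewrite mem_iota => /andP[_ kN] bk.
  by have [/(_ b bk)[bok ->] _ _] := sP k.
have SS N : S N.+1 = S N ++ s N.
  by rewrite /S -addn1 iotaD map_cat flatten_cat /= cats0.
(* Block words of different sizes are never conjugate, so the representatives for all k can be
   pooled. *)
have uS N : uniq (map key (S N)).
  elim: N => // N IHN; rewrite SS map_cat cat_uniq IHN /=.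
  have [sN us _] := sP N; rewrite us andbT; apply/hasPn => C /mapP[b /sN[bok sb] ->].
  apply/mapP => -[b' /SP[b'ok sb'] E].
  have := conj_class_size e_sym e_irr vU (gate_blocks_cat mc.1 bok) (gate_blocks_cat mc.1 b'ok) E.
  by rewrite !size_cat sb => /eqP; rewrite eqn_add2l => /eqP E'; rewrite -E' ltnn in sb'.
have geS N : \sum_(k < N) (2 * (m + k).+1%:R)^-1 <= \sum_(b <- S N) bweight b.
  elim: N => [|N IHN]; first by rewrite big_ord0 big_nil.
  by rewrite SS big_cat big_ord_recr lerD //; have [] := sP N.
(* W is the weight lost to the marker, and 2 comes from the bound one half. *)
have [N] := harmonic_unbounded m (2 * B / W); apply/negP; rewrite -leNgt.
rewrite ler_pdivlMr // mulrC -ler_pdivrMl ?ltr0n // mulrCA.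
have -> : 2^-1 * \sum_(k < N) ((m + k).+1%:R)^-1 = \sum_(k < N) (2 * (m + k).+1%:R)^-1 :> R.
  by rewrite mulr_sumr; apply: eq_bigr => k _; rewrite invfM.
apply: (@le_trans _ _ (\sum_(b <- S N) W * bweight b)).
  by rewrite -mulr_sumr ler_wpM2l // ltW.
apply: (@le_trans _ _ (\sum_(g <- [seq bprod (c ++ b) | b <- S N]) r ^+ len g)).
  rewrite big_map; apply: ler_sum => b _; rewrite -exprD rX_le //.
  apply: leq_trans (len_block_prod e_irr X _) _.
  by rewrite /blocks_weight big_cat.
by apply: conj_bound; rewrite -map_comp.
Qed.

End Step.

Variable B : R.
Hypothesis conj_bound : forall s : seq Gam, uniq (map (@conj_class Gam) s) ->
  \sum_(g <- s) r ^+ len g <= B.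
Hypothesis vertex_finite : forall v,
  (wsum [set: G v] (vweight v) < +oo)%E.

Lemma wsum_gpsub_finite U : (wsum (gpsub U : set Gam) gweight < +oo)%E.
Proof.
have [n] := ubnP #|U|; elim: n U => // n IHn U; rewrite ltnS => Un.
have [->|[v vU]] := set_0Vmem U.
  apply: (@le_lt_trans _ _ (wsum [set 1%g : Gam] gweight)).
    apply: wsum_subset => g /gpsubP[[|l w]]; first by rewrite gpw_nil.
    by rewrite /= inE.
  by rewrite /wsum esum_set1 ?ltry // lee_fin.
rewrite -(finset.setD1K vU); set U' := U :\ v.
have vU' : v \notin U' by rewrite !inE eqxx.
have U'n : (#|U'| < n)%N by apply: leq_trans Un; rewrite [X in (_ < X)%N](cardsD1 v) vU.
have Ufin := IHn U' U'n.
have [tau tau0 tauE] : exists2 tau : R, 0 <= tau & wsum (gate_reps v U') gweight = tau%:E.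
  apply: wsum_fin => [t|]; first exact: rX0.
  by apply: le_lt_trans Ufin; apply: wsum_subset => t [].
have [sigma sigma0 sigmaE] : exists2 sigma : R, 0 <= sigma &
    wsum (@nontriv v) (vweight v) = sigma%:E.
  apply: wsum_fin => [t|]; first exact: rX0.
  by apply: le_lt_trans (vertex_finite v); apply: wsum_subset.
have qE k := wsum_block_words k tau0 sigma0 tauE sigmaE.
have [q1|q1] := ltP (tau * sigma) 1; last by case: (step_infinite vU' conj_bound q1 qE).
by apply: (@step_finite v U' vU' (tau * sigma)) => //; rewrite mulr_ge0.
Qed.

Lemma wsum_all_finite : (wsum [set: Gam] gweight < +oo)%E.
Proof.
apply: le_lt_trans (wsum_gpsub_finite [set: V]); apply: wsum_subset => g _.
by have [w <-] := gpw_surj g; apply: gpw_sub; apply/allP => l _; rewrite /= inE.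
Qed.

End Growth.

(** * Growth rates *)

Section GrowthRates.
Local Open Scope ring_scope.
Variable R : realType.
Implicit Types (u : nat -> R) (x y C : R) (n : nat).

Definition roots u : nat -> R := fun n => u n `^ (n%:R^-1).

Definition rate u : R := limn_sup (roots u).

Lemma roots_ge0 u n : 0 <= roots u n.
Proof. exact: powR_ge0. Qed.

Lemma roots_le u n x : (0 < n)%N -> 0 <= u n -> 0 <= x -> (roots u n <= x) = (u n <= x ^+ n).
Proof.
move=> n0 un0 x0; rewrite -(ler_pXn2r n0) ?nnegrE ?roots_ge0 //; congr (_ <= _).
by rewrite -powR_mulrn ?roots_ge0 // -powRrM mulVf ?powRr1 // pnatr_eq0 -lt0n.
Qed.

Lemma exp_eventually_ge y C : 1 < y -> exists N, forall n, (N <= n)%N -> C <= y ^+ n.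
Proof.
move=> y1; pose C' := Num.max C 1.
have C'0 : 0 < C' by rewrite lt_max ltr01 orbT.
have y0 : 0 < y by apply: lt_trans y1.
have yv0 : 0 <= y^-1 by rewrite invr_ge0 ltW.
have : (fun n => y^-1 ^+ n) @ \oo --> (0 : R).
  by apply: cvg_expr; rewrite ger0_norm ?invr_ge0 ?ltW // invf_lt1.
move/cvgrPdist_lt => /(_ C'^-1); rewrite invr_gt0 => /(_ C'0)[N _ HN].
exists N => n Nn; have := HN n Nn; rewrite /= sub0r normrN (ger0_norm (exprn_ge0 n yv0)).
rewrite exprVn ltf_pV2 ?posrE ?exprn_gt0 // => /ltW; apply: le_trans.
by rewrite le_max lexx.
Qed.

Section Bounded.
Variables (u : nat -> R) (C0 x0 : R).
Hypothesis u0 : forall n, 0 <= u n.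
Hypotheses (C01 : 1 <= C0) (x01 : 1 <= x0).
Hypothesis uC : forall n, u n <= C0 * x0 ^+ n.

Let x0_ge0 : 0 <= x0. Proof. exact: le_trans x01. Qed.

(** [limn_sup] is meaningful only for bounded sequences; the exponential bound on u provides
    this. *)
Lemma roots_bound n : roots u n <= C0 * x0.
Proof.
have Cx : 1 <= C0 * x0 by rewrite -[1]mulr1 ler_pM.
(* At index 0 the exponent is 0^-1 = 0, so the root is 1, at most C0 x0. *)
case: n => [|n]; first by rewrite /roots invr0 powRr0.
rewrite roots_le // ?mulr_ge0 ?(le_trans ler01) //.
apply: le_trans (uC _) _; rewrite exprMn ler_wpM2r ?exprn_ge0 //.
by rewrite exprS ler_peMr ?exprn_ege1 // (le_trans ler01).
Qed.

Let ub : has_ubound (range (roots u)).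
Proof. by exists (C0 * x0) => _ [n _ <-]; exact: roots_bound. Qed.

Let lb : has_lbound (range (roots u)).
Proof. by exists 0 => _ [n _ <-]; exact: roots_ge0. Qed.

Let cvg_sups_roots : cvgn (sups (roots u)).
Proof. apply/cvg_ex; exists (inf (range (sups (roots u)))); exact: cvg_sups_inf. Qed.

Lemma limn_sup_lt x : 0 <= x -> rate u < x ->
  exists N, forall n, (N <= n)%N -> u n <= x ^+ n.
Proof.
move=> x_ge0 Lx.
have [N _ HN] : \forall n \near \oo, sups (roots u) n < x by exact: cvgr_lt Lx.
exists N.+1 => n Nn; rewrite -roots_le //; last exact: leq_trans Nn.
apply: le_trans (ltW (HN N (leqnn _))).
apply: ub_le_sup; first exact: has_ubound_sdrop.
by exists n => //=; exact: ltnW.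
Qed.

Lemma limn_sup_ge0 : 0 <= rate u.
Proof.
apply: limr_ge; first exact: cvg_sups_roots.
apply: nearW => n; apply: le_trans (roots_ge0 u n) _.
by apply: ub_le_sup; [exact: has_ubound_sdrop|exists n => /=].
Qed.

Lemma limn_sup_le x C : 0 < x -> (exists N, forall n, (N <= n)%N -> u n <= C * x ^+ n) ->
  rate u <= x.
Proof.
move=> x_gt0 [N HN]; apply/ler_addgt0Pr => eps eps0.
(* Powers of this quotient eventually absorb C. *)
have y1 : 1 < (x + eps) / x by rewrite ltr_pdivlMr // mul1r ltrDl.
have [N' HN'] := exp_eventually_ge C y1.
apply: limr_le; first exact: cvg_sups_roots.
near=> n; apply: ge_sup; first by exists (roots u n); exists n => /=.
move=> _ [m /= nm <-].
have nN : (maxn 1 (maxn N N') <= n)%N by near: n; exists (maxn 1 (maxn N N')).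
have := leq_trans nN nm; rewrite !geq_max => /and3P[m1 mN mN'].
have xe0 : 0 <= x + eps by rewrite addr_ge0 // ltW.
rewrite roots_le //.
apply: le_trans (HN m mN) _.
have := HN' m mN'; rewrite expr_div_n ler_pdivlMr // exprn_gt0 //.
Unshelve. all: by end_near. Qed.

Lemma limn_sup_summable r : 0 <= r -> r * rate u < 1 ->
  exists B, forall N, \sum_(k < N) u k * r ^+ k <= B.
Proof.
rewrite le_eqVlt => /predU1P[<- _|r0 rL].
  exists (u 0%N) => -[|N]; first by rewrite big_ord0.
  rewrite big_ord_recl big1 ?addr0 ?expr0 ?mulr1 // => i _.
  by rewrite expr0n /= mulr0.
have r_ge0 : 0 <= r by exact: ltW.
have Lr : rate u < r^-1 by rewrite -[r^-1]mul1r ltr_pdivlMr // mulrC.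
(* Strictly between the rate and r^-1, so that the terms are eventually at most (x r)^k with x r <
   1. *)
pose x := (rate u + r^-1) / 2.
have Lx : rate u < x by rewrite /x; lra.
have xr : x < r^-1 by rewrite /x; lra.
have x_ge0 : 0 <= x by apply: le_trans (ltW Lx); exact: limn_sup_ge0.
have [N HN] := limn_sup_lt x_ge0 Lx.
pose q := x * r; have q0 : 0 <= q by rewrite mulr_ge0 // ltW.
have q1 : q < 1 by rewrite -ltr_pdivlMr // mul1r.
exists (\sum_(k < N) u k * r ^+ k + (1 - q)^-1) => M.
apply: (@le_trans _ _ (\sum_(k < N + M) u k * r ^+ k)).
  rewrite addnC big_split_ord /= lerDl; apply: sumr_ge0 => i _.
  by rewrite mulr_ge0 // exprn_ge0 // ltW.
rewrite big_split_ord /= lerD2l.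
apply: (@le_trans _ _ (\sum_(k < M) q ^+ k)).
  apply: ler_sum => k _; apply: (@le_trans _ _ (q ^+ (N + k))).
    by rewrite exprMn ler_wpM2r ?exprn_ge0 // HN // leq_addr.
  by rewrite ler_wiXn2l ?leq_addl // ltW.
rewrite -[leRHS]mul1r ler_pdivlMr ?subr_gt0 // -[1 - q]opprB mulrN mulrC -subrX1 opprB.
by rewrite lerBlDr lerDl exprn_ge0.
Qed.

Lemma pseries_limn_sup x : cvgn (pseries u x) -> `|x| * rate u <= 1.
Proof.
move=> cx; have [->|xn0] := eqVneq x 0; first by rewrite normr0 mul0r.
have ax0 : 0 < `|x| by rewrite normr_gt0.
have /cvg_seq_bounded[M [_ HM]] : cvgn (fun n => u n * x ^+ n).
  by apply/cvg_ex; exists 0; exact: cvg_series_cvg_0.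
have {}HM n : u n <= (M + 1) * `|x|^-1 ^+ n.
  have := HM (M + 1); rewrite ltrDl ltr01 => /(_ isT n I) /=.
  rewrite normrM normrX ger0_norm // exprVn -ler_pdivrMr ?invr_gt0 ?exprn_gt0 //.
  by rewrite invrK.
rewrite mulrC -ler_pdivlMr // mul1r; apply: (@limn_sup_le _ (M + 1)); first by rewrite invr_gt0.
by exists 0%N.
Qed.

Lemma limn_sup_pseries x : `|x| * rate u < 1 -> cvgn (pseries u x).
Proof.
move=> xL; have [B HB] := limn_sup_summable (normr_ge0 x) xL.
apply: normed_cvg; apply: nondecreasing_is_cvgn.
  by apply: nondecreasing_series => k _ _ /=; exact: normr_ge0.
exists B => _ [N _ <-]; rewrite /normed_series_of /series /= big_mkord; apply: le_trans (HB N).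
by apply: ler_sum => k _; rewrite normrM normrX ger0_norm.
Qed.

End Bounded.

Lemma pseries_limn_sup_le u u' C0 x0 x y :
  (forall n, 0 <= u n) -> (forall n, 0 <= u' n) -> 1 <= C0 -> 1 <= x0 ->
  (forall n, u n <= C0 * x0 ^+ n) -> (forall n, u' n <= C0 * x0 ^+ n) ->
  rate u' <= rate u ->
  cvgn (pseries u x) -> `|y| < `|x| -> cvgn (pseries u' y).
Proof.
move=> u0 u'0 C1 x1 uC u'C L'L cx yx.
apply: (limn_sup_pseries u'0 C1 x1 u'C).
have := limn_sup_ge0 u'0 C1 x1 u'C; rewrite le_eqVlt => /predU1P[<-|L'0].
  by rewrite mulr0 ltr01.
apply: lt_le_trans (pseries_limn_sup u0 C1 x1 uC cx).
apply: (@lt_le_trans _ _ (`|x| * rate u')); first by rewrite ltr_pM2r.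
exact: ler_wpM2l (normr_ge0 x) _ _ L'L.
Qed.

Lemma convergence_radius_le u u' :
  (forall x y, cvgn (pseries u x) -> `|y| < `|x| -> cvgn (pseries u' y)) ->
  (convergence_radius u <= convergence_radius u')%E.
Proof.
move=> H; apply: ge_ereal_sup => _ [x cx <-].
have le y : 0 <= y -> y < `|x| -> (y%:E <= convergence_radius u')%E.
  move=> y0 yx; apply: ereal_sup_ubound; exists y; last by rewrite ger0_norm.
  by apply: (H x) => //; rewrite ger0_norm.
(* This excludes the value -oo and makes the midpoint taken below nonnegative. At 0 the partial sums
   are constant from index 1 on, as 0^0 = 1. *)
have zero_in : (0%:E <= convergence_radius u')%E.
  apply: ereal_sup_ubound; exists 0; last by rewrite normr0.
  rewrite /=; apply: (is_cvg_near_cst (u' 0%N)); exists 1%N => // n /= n0.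
  rewrite /pseries /series /= -(prednK n0) big_nat_recl // expr0 mulr1.
  by rewrite big1 ?addr0 // => k _; rewrite expr0n mulr0.
move: (convergence_radius u') le zero_in => [rho| |] le;
  rewrite ?leey ?leeNy_eq // !lee_fin => rho0.
rewrite leNgt; apply/negP => rhox; have [rm mx] := midf_lt rhox.
by have := le _ (le_trans rho0 (ltW rm)) mx; rewrite lee_fin leNgt rm.
Qed.

(* Fekete's lemma, from the fact that the limit superior of the roots is a lower bound of all
   roots of positive index. *)
Lemma submul_cvg_roots u C0 x0 : (forall n, 0 <= u n) -> 1 <= C0 -> 1 <= x0 ->
  (forall n, u n <= C0 * x0 ^+ n) -> (forall m n, u (m + n)%N <= u m * u n) ->
  roots u @ \oo --> rate u.
Proof.
move=> u0 C1 x1 uC subm; set L := rate u.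
have Lroot d : (0 < d)%N -> L <= roots u d.
  move=> d0; apply/ler_addgt0Pr => eps eps0; set x := _ + eps.
  have x_gt0 : 0 < x by rewrite ltr_wpDl // roots_ge0.
  (* The constant bounds u p / x^p for whichever remainder p of n modulo d occurs. *)
  apply: (limn_sup_le u0 C1 x1 uC (C := \sum_(p < d) u p / x ^+ p)) => //.
  exists 0%N => n _; rewrite {1}(divn_eq n d).
  have x_ge0 : 0 <= x by exact: ltW.
  have udx : u d <= x ^+ d by rewrite -roots_le // lerDl ltW.
  have pow q : u (q * d + n %% d)%N <= x ^+ (q * d) * u (n %% d)%N.
    elim: q => [|q IHq]; first by rewrite mul0n add0n expr0 mul1r.
    rewrite mulSn -addnA; apply: le_trans (subm _ _) _.
    by rewrite exprD -mulrA ler_pM.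
  apply: le_trans (pow _) _.
  have -> : x ^+ (n %/ d * d) * u (n %% d)%N = u (n %% d)%N / x ^+ (n %% d) * x ^+ n.
    rewrite [X in _ = _ * x ^+ X](divn_eq n d) exprD mulrC [in RHS]mulrCA -mulrA mulVf ?mulr1.
      by rewrite mulrC.
    by rewrite expf_neq0 // gt_eqF.
  rewrite ler_wpM2r ?exprn_ge0 //.
  have nd : (n %% d < d)%N by rewrite ltn_mod.
  rewrite (bigD1 (Ordinal nd)) //= lerDl; apply: sumr_ge0 => p _.
  by rewrite divr_ge0 // exprn_ge0.
apply/cvgrPdist_le => eps eps0.
have L0 : 0 <= L := limn_sup_ge0 u0 C1 x1 uC.
have [N HN] : exists N, forall n, (N <= n)%N -> u n <= (L + eps) ^+ n.
  by apply: (limn_sup_lt u0 C1 x1 uC); rewrite ?ltrDl // addr_ge0 // ltW.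
exists N.+1 => // n /= Nn; have n0 : (0 < n)%N by exact: leq_trans Nn.
have := Lroot n n0; have : roots u n <= L + eps.
  have Le0 : 0 <= L + eps by rewrite addr_ge0 // ltW.
  by rewrite roots_le // HN // ltnW.
by move=> *; rewrite ler_norml; apply/andP; split; lra.
Qed.

End GrowthRates.

Local Open Scope ring_scope.

(** * Spheres, conjugacy spheres and their counting sums *)

Lemma card_fset_image_le (T T' : choiceType) (f : T -> T') (A : set T') (B : set T) :
  finite_set B -> A `<=` f @` B ->
  finite_set A /\ (#|` fset_set A| <= #|` fset_set B|)%N.
Proof.
move=> finB AB; have finfB : finite_set (f @` B) by exact: finite_image.
have finA : finite_set A by exact: sub_finite_set finfB.
split=> //; apply: (@leq_trans #|` fset_set (f @` B)|).
  by apply: fsubset_leq_card; rewrite -fset_set_sub.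
by rewrite fset_set_image // leq_imfset_card.
Qed.

Lemma uniq_size_card (T : choiceType) (A : set T) (s : seq T) : finite_set A -> uniq s ->
  (forall x, x \in s -> A x) -> (size s <= #|` fset_set A|)%N.
Proof.
move=> finA us sA; rewrite -[X in (_ <= X)%N]/(size (fset_set A)); apply: uniq_leq_size => // x xs.
by rewrite in_fset_set // inE; exact: sA.
Qed.

Lemma sum_by_size (R : realType) (T : choiceType) (D : set T) (f : T -> nat) (c : nat -> nat)
    (r B : R) :
  0 <= r -> (forall n s, uniq s -> (forall x, x \in s -> D x /\ f x = n) -> (size s <= c n)%N) ->
  (forall N, \sum_(k < N) (c k)%:R * r ^+ k <= B) ->
  forall s, uniq s -> (forall x, x \in s -> D x) -> \sum_(x <- s) r ^+ f x <= B.
Proof.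
move=> r0 cP cB s us sD; pose N := (\max_(x <- s) f x).+1.
have -> : \sum_(x <- s) r ^+ f x = \sum_(k < N) \sum_(x <- s | f x == k) r ^+ f x.
  rewrite (exchange_big_dep predT) //=; apply: eq_big_seq => x xs.
  have xN : (f x < N)%N by rewrite ltnS; exact: leq_bigmax_seq.
  by rewrite (big_pred1 (Ordinal xN)) // => k; rewrite -val_eqE /= eq_sym.
apply: le_trans (cB N); apply: ler_sum => k _.
under eq_bigr => x /eqP -> do [].
rewrite big_const_seq iter_addr_0 -[leLHS]mulr_natl ler_wpM2r ?exprn_ge0 // ler_nat -size_filter.
apply: cP; first exact: filter_uniq.
by move=> x; rewrite mem_filter => /andP[/eqP fx /sD].
Qed.

Section Spheres.
Variables (G : groupType) (X : genset G).
Local Notation len := (word_length X).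

Lemma word_length_split m n g : len g = (m + n)%N ->
  exists g1 g2, [/\ g = (g1 * g2)%g, len g1 = m & len g2 = n].
Proof.
have [w [wX sw wE]] := word_lengthP X g => lg.
have le1 : (len (\prod_(x <- take m w) x)%g <= m)%N.
  apply: (@leq_trans (size (take m w))); last by rewrite size_take sw lg; case: ltnP => //; lia.
  by apply: word_length_le => x /mem_take/wX.
have le2 : (len (\prod_(x <- drop m w) x)%g <= n)%N.
  apply: (@leq_trans (size (drop m w))); last by rewrite size_drop sw lg addKn.
  by apply: word_length_le => x /mem_drop/wX.
have gE : g = ((\prod_(x <- take m w) x) * (\prod_(x <- drop m w) x))%g.
  by rewrite -big_cat cat_take_drop wE.
have := word_lengthM X (\prod_(x <- take m w) x)%g (\prod_(x <- drop m w) x)%g.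
rewrite -gE lg => le3; exists (\prod_(x <- take m w) x)%g, (\prod_(x <- drop m w) x)%g.
by split=> //; lia.
Qed.

Lemma sphere0 : sphere X 0 = [set 1%g].
Proof.
by apply/seteqP; split=> [g /word_length_eq0|g ->]; [|exact: word_length1].
Qed.

Lemma sphere_split m n :
  sphere X (m + n) `<=` (fun p : G * G => (p.1 * p.2)%g) @` (sphere X m `*` sphere X n).
Proof. by move=> g /word_length_split[g1 [g2 [-> l1 l2]]]; exists (g1, g2). Qed.

Lemma sphere_finite n : finite_set (sphere X n).
Proof.
elim: n => [|n IHn]; first by rewrite sphere0.
have fin1 : finite_set (sphere X 1).
  apply: sub_finite_set (gens_finite X) => g /= g1.
  have [[|x [|y w]] [wX]] := word_lengthP X g; rewrite g1 // big_seq1 => _ <-.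
  by apply: wX; rewrite mem_head.
rewrite -add1n; apply: (card_fset_image_le _ (@sphere_split 1 n)).1.
exact: finite_setX.
Qed.

Lemma sphere_size_submul m n : (sphere_size X (m + n) <= sphere_size X m * sphere_size X n)%N.
Proof.
have fmn : finite_set (sphere X m `*` sphere X n) by apply: finite_setX; exact: sphere_finite.
have [_ le] := card_fset_image_le fmn (@sphere_split m n).
apply: (leq_trans le); rewrite fset_setX; try exact: sphere_finite.
rewrite -[X in (_ <= X)%N](size_allpairs pair (fset_set (sphere X m)) (fset_set (sphere X n))).
apply: uniq_leq_size; first exact: fset_uniq.
by move=> [x y]; rewrite in_fsetM => /andP[xm yn]; exact: allpairs_f.
Qed.

Lemma conj_classJ (g h : G) : conj_class (g ^ h)%g = conj_class g.
Proof.
apply/seteqP; split=> [_ [k _ <-]|_ [k _ <-]].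
  by exists (h * k)%g => //; rewrite conjgM.
by exists (h^-1 * k)%g => //; rewrite -conjgM mulVKg.
Qed.

Lemma conj_class_refl (g : G) : conj_class g g.
Proof. by exists 1%g => //; exact: conjg1. Qed.

Lemma conj_sphere_sub n : conj_sphere X n `<=` (@conj_class G) @` sphere X n.
Proof. by move=> C [g -> [lg _]]; exists g. Qed.

Lemma conj_sphere_finite n : finite_set (conj_sphere X n).
Proof. exact: (card_fset_image_le (sphere_finite n) (@conj_sphere_sub n)).1. Qed.

Lemma conj_sphere_size_le n : (conj_sphere_size X n <= sphere_size X n)%N.
Proof. exact: (card_fset_image_le (sphere_finite n) (@conj_sphere_sub n)).2. Qed.

Lemma conj_sphere_exists g : exists n, conj_sphere X n (conj_class g).
Proof.
have ex : exists n, `[< exists2 h, conj_class g h & len h = n >].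
  by exists (len g); apply/asboolP; exists g => //; exact: conj_class_refl.
case: (ex_minnP ex) => n /asboolP[_ [k _ <-] lh] nmin; exists n, (g ^ k)%g.
  by rewrite conj_classJ.
by split=> // h gh; apply: nmin; apply/asboolP; exists h.
Qed.

Variable R : realType.

Lemma spherical_coef_ge0 n : 0 <= spherical_growth_coef X R n.
Proof. exact: ler0n. Qed.

Lemma conj_coef_ge0 n : 0 <= conj_growth_coef X R n.
Proof. exact: ler0n. Qed.

Lemma conj_coef_le n : conj_growth_coef X R n <= spherical_growth_coef X R n.
Proof. by rewrite ler_nat conj_sphere_size_le. Qed.

Lemma spherical_coef_bound : exists2 x0 : R, 1 <= x0 &
  forall n, spherical_growth_coef X R n <= 1 * x0 ^+ n.
Proof.
exists (1 + spherical_growth_coef X R 1); first by rewrite lerDl spherical_coef_ge0.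
elim=> [|n IHn].
  by rewrite mul1r expr0 /spherical_growth_coef /sphere_size sphere0 fset_set1 cardfs1.
apply: (@le_trans _ _ (spherical_growth_coef X R 1 * spherical_growth_coef X R n)).
  by rewrite -natrM ler_nat -add1n sphere_size_submul.
rewrite mul1r exprS; rewrite mul1r in IHn.
by apply: ler_pM => //; rewrite ?spherical_coef_ge0 ?lerDr.
Qed.

(** The definition uses [limn]; it agrees with the limit superior because submultiplicativity gives
    convergence. *)
Lemma spherical_growth_rateE : spherical_growth_rate X R = rate (spherical_growth_coef X R).
Proof.
have [x0 x01 bnd] := spherical_coef_bound.
apply: cvg_lim => //; apply: (submul_cvg_roots spherical_coef_ge0 (lexx 1) x01 bnd) => m n.
by rewrite -natrM ler_nat sphere_size_submul.
Qed.

Lemma conj_growth_rateE : conj_growth_rate X R = rate (conj_growth_coef X R).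
Proof. by []. Qed.

Lemma wsum_group_finite (r B : R) : 0 <= r ->
  (forall N, \sum_(k < N) spherical_growth_coef X R k * r ^+ k <= B) ->
  (wsum [set: G] (fun g => r ^+ len g)%R < +oo)%E.
Proof.
move=> r0 H; apply: (@le_lt_trans _ _ B%:E); last exact: ltry.
apply: wsum_le => s us sD; rewrite lee_fin.
apply: (sum_by_size (D := [set: G]) (f := len) (c := sphere_size X)) => // n s' us' s'P.
by apply: uniq_size_card => //; [exact: sphere_finite|move=> x /s'P[]].
Qed.

(** Each g is at least as long as the shortest elements of its class, so with r <= 1 its weight is
    at most theirs. *)
Lemma conj_class_sum_bound (r B : R) : 0 <= r -> r <= 1 ->
  (forall N, \sum_(k < N) conj_growth_coef X R k * r ^+ k <= B) ->
  forall s : seq G, uniq (map (@conj_class G) s) -> \sum_(g <- s) r ^+ len g <= B.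
Proof.
move=> r0 r1 H s us.
pose cl (C : set G) : nat := xget 0%N [set n | conj_sphere X n C].
have clP g : conj_sphere X (cl (conj_class g)) (conj_class g).
  have [n nP] := conj_sphere_exists g.
  exact: (xgetPex 0%N (ex_intro (fun n => conj_sphere X n (conj_class g)) n nP)).
apply: (@le_trans _ _ (\sum_(C <- map (@conj_class G) s) r ^+ cl C)).
  rewrite big_map; apply: ler_sum => g _; rewrite ler_wiXn2l //.
  have [h _ [_ le]] := clP g; apply: le; exact: conj_class_refl.
apply: (sum_by_size (D := range (@conj_class G)) (c := conj_sphere_size X)) => //; last first.
  by move=> C /mapP[g _ ->]; exists g.
move=> n s' us' s'P; apply: uniq_size_card => //; first exact: conj_sphere_finite.
by move=> C /s'P[[g _ <-] <-].
Qed.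

Lemma sphere_sum_bound (r C : R) : (wsum [set: G] (fun g => r ^+ len g)%R <= C%:E)%E ->
  forall N, \sum_(k < N) spherical_growth_coef X R k * r ^+ k <= C.
Proof.
move=> H N.
have [s [us sN sE]] : exists s : seq G, [/\ uniq s, forall g, g \in s -> (len g < N)%N &
    \sum_(g <- s) r ^+ len g = \sum_(k < N) spherical_growth_coef X R k * r ^+ k].
  elim: N => [|N [s [us sN sE]]]; first by exists [::]; rewrite big_nil big_ord0.
  have sphP g : (g \in fset_set (sphere X N)) = (len g == N).
    by rewrite in_fset_set; [apply/idP/eqP; rewrite inE|exact: sphere_finite].
  exists (s ++ fset_set (sphere X N)); split.
  - rewrite cat_uniq us fset_uniq andbT; apply/hasPn => g; rewrite sphP => /eqP gN.
    by apply/negP => /sN; rewrite gN ltnn.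
  - by move=> g; rewrite mem_cat sphP ltnS => /orP[/sN/ltnW //|/eqP ->].
  - rewrite big_cat big_ord_recr /= sE; congr (_ + _).
    rewrite (eq_big_seq (fun=> r ^+ N)); last by move=> g; rewrite sphP => /eqP ->.
    by rewrite big_const_seq count_predT iter_addr_0 -mulr_natl.
by rewrite -sE -lee_fin; apply: le_trans H; exact: wsum_seq.
Qed.

End Spheres.

Lemma rate_le (R : realType) (u u' : nat -> R) (C0 x0 : R) :
  (forall n, 0 <= u n) -> (forall n, u n <= u' n) -> 1 <= C0 -> 1 <= x0 ->
  (forall n, u' n <= C0 * x0 ^+ n) -> rate u <= rate u'.
Proof.
move=> u0 uu' C1 x1 u'C.
have u'0 n : 0 <= u' n by exact: le_trans (uu' n).
have uC n : u n <= C0 * x0 ^+ n by exact: le_trans (uu' n) (u'C n).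
apply/ler_addgt0Pr => eps eps0.
have rate0 := limn_sup_ge0 u'0 C1 x1 u'C.
have x_gt0 : 0 < rate u' + eps by rewrite ltr_wpDl.
have lt : rate u' < rate u' + eps by rewrite ltrDl.
have [N HN] := limn_sup_lt u'0 C1 x1 u'C (ltW x_gt0) lt.
apply: (limn_sup_le u0 C1 x1 uC (C := 1)) => //; exists N => n Nn.
by rewrite mul1r; apply: le_trans (HN n Nn).
Qed.

Section VertexSpheres.
Variables (V : finType) (e : rel V) (G : V -> groupType).
Hypotheses (e_irr : irreflexive e).
Variable X : forall v, genset (G v).
Local Notation Gam := (graph_product e G).
Local Notation len := (word_length (gp_genset e X)).

(** The projection to G_v maps the class of g in the graph product onto its class in G_v without
    increasing length. Distinct classes thus stay distinct and keep their minimal length. *)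
Lemma vertex_conj_sphere_size_le v n :
  (conj_sphere_size (X v) n <= conj_sphere_size (gp_genset e X) n)%N.
Proof.
apply: (card_fset_image_le (f := fun C : set Gam => vretr v @` C) _ _).2.
  exact: conj_sphere_finite.
have vJ (x h : Gam) : vretr v (x ^ h)%g = (vretr v x ^ vretr v h)%g.
  by rewrite !conjgE !vretrM // vretrV.
move=> _ [g -> [lg gmin]].
have classE : vretr v @` conj_class (gp_in e g) = conj_class g.
  apply/seteqP; split=> [_ [_ [h _ <-] <-]|_ [k _ <-]].
    by rewrite vJ vretr_in //; exists (vretr v h).
  by exists (gp_in e g ^ gp_in e k)%g; [exists (gp_in e k)|rewrite vJ !vretr_in].
exists (conj_class (gp_in e g)) => //; exists (gp_in e g) => //; split; first by rewrite len_in.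
move=> h gh; apply: leq_trans (len_vretr e_irr X v h); apply: gmin.
by rewrite -classE; exists h.
Qed.

End VertexSpheres.

(** * Comparison of the two growth rates and radii *)

Section Assembly.
Variables (R : realType) (V : finType) (e : rel V).
Hypotheses (e_sym : symmetric e) (e_irr : irreflexive e).
Variable G : V -> groupType.
Hypothesis G_nontrivial : forall v, exists g : G v, g <> 1%g.
Variable X : forall v, genset (G v).
Hypothesis HX : forall v, spherical_growth_rate (X v) R = conj_growth_rate (X v) R.

Let a : nat -> R := spherical_growth_coef (gp_genset e X) R.
Let c : nat -> R := conj_growth_coef (gp_genset e X) R.

Let rate_c_ge0 : 0 <= rate c.
Proof.
have [x0 x01 bnd] := spherical_coef_bound (gp_genset e X) R.
apply: (limn_sup_ge0 (conj_coef_ge0 _ R) (lexx 1) x01) => n.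
exact: le_trans (conj_coef_le _ R n) (bnd n).
Qed.

Let rate_ca : rate c <= rate a.
Proof.
have [x0 x01 bnd] := spherical_coef_bound (gp_genset e X) R.
exact: (rate_le (conj_coef_ge0 _ R) (conj_coef_le _ R) (lexx 1) x01 bnd).
Qed.

(** The hypothesis on the vertex groups enters here: it turns the comparison of conjugacy growth
    into a bound on the spherical growth of G_v. *)
Lemma vertex_rate_le v : rate (spherical_growth_coef (X v) R) <= rate c.
Proof.
have [x0 x01 bnd] := spherical_coef_bound (gp_genset e X) R.
rewrite -spherical_growth_rateE HX conj_growth_rateE.
apply: (rate_le (conj_coef_ge0 _ R) _ (lexx 1) x01).
  by move=> n; rewrite ler_nat vertex_conj_sphere_size_le.
by move=> n; exact: le_trans (conj_coef_le _ R n) (bnd n).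
Qed.

Lemma spherical_sums_bounded r : 0 < r -> r <= 1 -> r * rate c < 1 ->
  exists C, forall N, \sum_(k < N) a k * r ^+ k <= C.
Proof.
move=> r0 r1 rc.
have [x0 x01 bnd] := spherical_coef_bound (gp_genset e X) R.
have bndc n : c n <= 1 * x0 ^+ n := le_trans (conj_coef_le _ R n) (bnd n).
have [B HB] := limn_sup_summable (conj_coef_ge0 _ R) (lexx 1) x01 bndc (ltW r0) rc.
have vfin v : (wsum [set: G v] (fun g => r ^+ word_length (X v) g)%R < +oo)%E.
  have [y0 y01 bndv] := spherical_coef_bound (X v) R.
  have [|B' HB'] := limn_sup_summable (spherical_coef_ge0 (X v) R) (lexx 1) y01 bndv (ltW r0).
    by apply: le_lt_trans rc; apply: ler_wpM2l (vertex_rate_le v); exact: ltW.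
  exact: wsum_group_finite (ltW r0) HB'.
have fin := wsum_all_finite e_sym e_irr G_nontrivial r0 r1
  (conj_class_sum_bound (ltW r0) r1 HB) vfin.
have [C _ CE] := wsum_fin (fun g => exprn_ge0 _ (ltW r0)) fin.
by exists C; apply: sphere_sum_bound; rewrite CE.
Qed.

Lemma rate_ac : rate a <= rate c.
Proof.
have [x0 x01 bnd] := spherical_coef_bound (gp_genset e X) R.
have a0 := spherical_coef_ge0 (gp_genset e X) R.
have limn_le := limn_sup_le a0 (lexx 1) x01 bnd.
rewrite leNgt; apply/negP => ca.
have [a1|a1] := ltP 1 (rate a).
  (* The maximum with 1 keeps r = m^-1 within the range r <= 1 of [spherical_sums_bounded]. *)
  pose mu := Num.max (rate c) 1.
  have mu1 : 1 <= mu by rewrite le_max lexx orbT.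
  have muc : rate c <= mu by rewrite le_max lexx.
  have mua : mu < rate a by rewrite gt_max ca.
  have [mum ma] := midf_lt mua; set m := (mu + rate a) / 2 in mum ma.
  have m1 : 1 <= m by exact: le_trans (ltW mum).
  have m0 : 0 < m by exact: lt_le_trans m1.
  have [|||C HC] := @spherical_sums_bounded m^-1.
  - by rewrite invr_gt0.
  - by rewrite invf_le1.
  - by rewrite mulrC ltr_pdivrMr // mul1r; exact: le_lt_trans mum.
  have : rate a <= m.
    apply: (limn_le m C m0); exists 0%N => n _.
    rewrite -ler_pdivrMr ?exprn_gt0 // -exprVn; apply: le_trans (HC n.+1).
    rewrite big_ord_recr /= lerDr; apply: sumr_ge0 => k _.
    by rewrite mulr_ge0 ?exprn_ge0 ?invr_ge0 ?(ltW m0) ?ler0n.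
  by rewrite leNgt ma.
(* Here the sums are bounded at r = 1, so the group is finite. *)
have [|||C HC] := @spherical_sums_bounded 1; rewrite ?ltr01 // ?mul1r.
  exact: lt_le_trans ca a1.
have /cvg_series_cvg_0 : cvgn (series a).
  apply: nondecreasing_is_cvgn; first by apply: nondecreasing_series => k _ _; exact: a0.
  exists C => _ [N _ <-]; rewrite /series /= big_mkord; apply: le_trans (HC N).
  by apply: ler_sum => k _; rewrite expr1n mulr1.
(* Natural numbers tending to 0 vanish from some index on. *)
move/cvgrPdist_lt => /(_ 1 ltr01)[N _ HN].
have aN n : (N <= n)%N -> a n = 0.
  move=> Nn; have := HN n Nn; rewrite sub0r normrN ger0_norm // -[1]/(1%:R) ltr_nat ltnS leqn0.
  by rewrite /a /spherical_growth_coef => /eqP ->.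
have : rate a <= 0.
  apply/ler_addgt0Pr => eps eps0; rewrite add0r.
  by apply: (limn_le eps 0 eps0); exists N => n Nn; rewrite mul0r -[leLHS]/(a n) aN.
by rewrite leNgt (le_lt_trans rate_c_ge0 ca).
Qed.

Lemma rate_eq : rate a = rate c.
Proof. exact: le_anti (introT andP (conj rate_ac rate_ca)). Qed.

Lemma radius_eq : convergence_radius a = convergence_radius c.
Proof.
have [x0 x01 bnd] := spherical_coef_bound (gp_genset e X) R.
have a0 := spherical_coef_ge0 (gp_genset e X) R.
have c0 := conj_coef_ge0 (gp_genset e X) R.
have bndc n : c n <= 1 * x0 ^+ n := le_trans (conj_coef_le _ R n) (bnd n).
apply/eqP; rewrite eq_le; apply/andP; split; apply: convergence_radius_le => x y.
  exact: (pseries_limn_sup_le a0 c0 (lexx 1) x01 bnd bndc rate_ca).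
exact: (pseries_limn_sup_le c0 a0 (lexx 1) x01 bndc bnd rate_ac).
Qed.

End Assembly.

Theorem theorem2 (R : realType) (V : finType) (e : rel V)
    (e_sym : symmetric e) (e_irr : irreflexive e)
    (G : V -> groupType) (G_nontrivial : forall v, exists g : G v, g <> 1%g)
    (X : forall v, genset (G v))
    (HX : forall v, spherical_growth_rate (X v) R = conj_growth_rate (X v) R) :
  spherical_growth_rate (gp_genset e X) R = conj_growth_rate (gp_genset e X) R
  /\ convergence_radius (spherical_growth_coef (gp_genset e X) R)
     = convergence_radius (conj_growth_coef (gp_genset e X) R).
Proof.
split; last exact: radius_eq.
by rewrite spherical_growth_rateE conj_growth_rateE; exact: rate_eq.
Qed.
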